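(* Let $\mu$ be a probability measure on $\mathbb{R}^d$ with closed support $D$, let $\{V_n\}_{n=0}^\infty\subset L^2_\mu(D)$ be a hierarchical sequence of finite-dimensional subspaces with $N_n=\dim V_n$ and $q^*<\infty$, and let $\epsilon>0$. For each $n$ let $\mathcal{A}_n$ consist of $|\mathcal{A}_n|$ i.i.d. samples from a probability measure $\rho_n$. For each of the three choices of $\rho_n$ below there is a choice of sample sizes $|\mathcal{A}_n|$ such that, with probability $1$, there are finite constants $k_a=k_a(\epsilon)$, $k_b=k_b(\epsilon,\omega)$ and $N=N(\omega)$ (where $\omega$ denotes the realization of the random samples) for which $$\sup_{x\in D}|v(x)|\le k_b N_n^b\max_{x\in\mathcal{A}_n}|v(x)|\quad\text{for all } v\in V_n,\qquad |\mathcal{A}_n|\le k_aN_n^a,\qquad\text{for all } n\ge N,$$ with the indicated exponents $a,b$: 1. $\rho_n=\mu$ for all $n$: $a=q^*+\epsilon$ and $b=\frac{q^*}{2}+\epsilon$ (so $\{\mathcal{A}_n\}$ is an asymptotic WAM). 2. $\rho_n=\mu_{V_n}$, assuming $1\in V_0$: $a=1+\epsilon$ and $b=\frac{q^*+1}{2}+\epsilon$ (so $\{\mathcal{A}_n\}$ is an asymptotic WAM). 3. $\rho_n=\nu_n$, assuming that $D$ is convex and compact with non-empty interior, that the elements of every $V_n$ are smooth (twice continuously differentiable), that $R_n>0$ on $D$ for every $n$, and that $p^*<\infty$: $a=p^*+\epsilon$ and $b=0$ (so $\{\mathcal{A}_n\}$ is an asymptotic AM).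
   Context: Functions are complex-valued and defined pointwise on $D=\operatorname{supp}\mu$. $L^2_\mu(D)$ has inner product $\langle f,g\rangle_\mu=\int f\bar g\,d\mu$ and norm $\|\cdot\|_{2,\mu}$. Hierarchical means $V_n\subset V_{n+1}$ and $\dim V_n<\dim V_{n+1}$, with $N_n=\dim V_n\geq 1$ finite. For an $N$-dimensional $V\subset L^2_\mu(D)$ with $L^2_\mu$-orthonormal basis $v_1,\dots,v_N$, set $K(x,x)=\sum_{i=1}^N|v_i(x)|^2$ and $K_\mu(V)=\sup_{x\in D}K(x,x)$ (both independent of the basis); $K_\mu(V_n)$ is assumed finite for all $n$. Define $q^*=\limsup_{n\to\infty}\frac{\log K_\mu(V_n)}{\log N_n}$. The $V$-induced measure is the probability measure $d\mu_V(x)=\frac1N K(x,x)\,d\mu(x)$. For item 3: $R_n(x)=\left(\sum_{i=1}^{N_n}\|\nabla v_i(x)\|^2\right)^{1/2}$, where $v_1,\dots,v_{N_n}$ is an orthonormal basis of $V_n$ (independent of the basis), $R_\mu(V_n)=\max_{x\in D}R_n(x)$, and $d\nu_n(x)=\frac{R_n(x)^d}{\int_DR_n(y)^d\,dy}\,dx$ on $D$. Let $B_r(x)$ be the closed Euclidean ball of radius $r$ at $x$. For continuous $f:D\to(0,\infty)$ with $m_f=\min_Df$, let $F_r(y)=\frac{\min_{z\in B_r(y)\cap D}f(z)}{m_f}$ and $r(y,\epsilon')=\max_{c\ge0}\min\{\epsilon'F_c(y),c\}$. A finite set $\mathcal{N}\subset D$ is an $f$-weighted $\epsilon'$-covering of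 $D$ if $D\subset\bigcup_{y\in\mathcal{N}}B_{r_y}(y)$ for some radii $r_y\le r(y,\epsilon')$; $\mathcal{S}_{f,\epsilon'}(D)$ is the set of all such $\mathcal{N}$, and for $\mathcal{N}\in\mathcal{S}_{f,\epsilon'}(D)$, $$G_{\mathcal{N}}=\max_{y\in\mathcal{N}}\left(\frac{\max_{x\in B_{r(y,\epsilon')}(y)\cap D}f(x)}{\min_{x\in B_{r(y,\epsilon')}(y)\cap D}f(x)}\right)^d.$$ With $f=R_n^{-1}$ and $\epsilon_n=(3R_\mu(V_n))^{-1}$, set $p^*=\limsup_{n\to\infty}\frac{\log\left(\inf_{\mathcal{N}\in\mathcal{S}_{f,\epsilon_n}(D)}|\mathcal{N}|\,G_{\mathcal{N}}\right)}{\log N_n}$. *)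

(* Defs.v *)
From HB Require Import structures.
From mathcomp Require Import all_boot all_order all_algebra finmap.
From mathcomp Require Import complex.
From mathcomp Require Import all_classical all_reals all_analysis.
Set Implicit Arguments.
Unset Strict Implicit.
Unset Printing Implicit Defensive.
Import Order.TTheory GRing.Theory Num.Theory.
Import numFieldNormedType.Exports.
Local Open Scope classical_set_scope.
Local Open Scope ring_scope.

(* R^d with its Borel sigma-algebra. It is convertible to 'rV[R]_d, so points
   and functions pass freely between the two types. The library's norm and
   topology on 'rV[R]_d are those of the sup norm; the Euclidean norm is
   [enorm] below. *)
Notation borel_rV R d := (g_sigma_algebraType (@open 'rV[R]_d)).

Definition pushforward_measure d d' (T1 : measurableType d)
    (T2 : measurableType d') (R : realFieldType)
    (m : {measure set T1 -> \bar R}) (f : T1 -> T2)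
    (mf : measurable_fun [set: T1] f) : {measure set T2 -> \bar R} :=
  measure_function_pushforward__canonical__measure_function_Measure m mf.

Section lebesgue_tuple.
Context {R : realType} {n : nat}.
Variable m : {sigma_finite_measure set (n.-tuple (measurableTypeR R)) -> \bar R}.

Definition pair_cons (p : measurableTypeR R * n.-tuple (measurableTypeR R)) :
  n.+1.-tuple (measurableTypeR R) := [the n.+1.-tuple _ of p.1 :: p.2].

Lemma measurable_pair_cons : measurable_fun [set: _] pair_cons.
Proof. exact: measurable_cons. Qed.

Definition lebesgue_cons :
    set (n.+1.-tuple (measurableTypeR R)) -> \bar R :=
  pushforward ((@lebesgue_measure R) \x m)%E pair_cons.

Let lebesgue_cons0 : lebesgue_cons set0 = 0%E.
Proof. exact: (measure0 (pushforward_measure _ measurable_pair_cons)). Qed.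

Let lebesgue_cons_ge0 A : (0 <= lebesgue_cons A)%E.
Proof. exact: (measure_ge0 (pushforward_measure _ measurable_pair_cons)). Qed.

Let lebesgue_cons_sigma_additive : semi_sigma_additive lebesgue_cons.
Proof.
exact: (@measure_semi_sigma_additive _ _ _
  (pushforward_measure _ measurable_pair_cons)).
Qed.

HB.instance Definition _ := isMeasure.Build _ _ _ lebesgue_cons
  lebesgue_cons0 lebesgue_cons_ge0 lebesgue_cons_sigma_additive.

Lemma lebesgue_cons_sigma_finite : sigma_finite setT lebesgue_cons.
Proof.
have /sigma_finiteP[F [TF ndF Foo]] := sigma_finiteT (@lebesgue_measure R).
have /sigma_finiteP[G [TG ndG Goo]] := sigma_finiteT m.
pose hd (t : n.+1.-tuple (measurableTypeR R)) := tnth t ord0.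
pose tl (t : n.+1.-tuple (measurableTypeR R)) := [tuple of behead t].
exists (fun k => hd @^-1` F k `&` tl @^-1` G k).
  apply/seteqP; split=> // t _.
  have [i _ Fi] : (\bigcup_i F i) (hd t) by rewrite -TF.
  have [j _ Gj] : (\bigcup_i G i) (tl t) by rewrite -TG.
  exists (maxn i j) => //; split=> /=.
  - by move: (hd t) Fi; exact/subsetPset/ndF/leq_maxl.
  - by move: (tl t) Gj; exact/subsetPset/ndG/leq_maxr.
move=> k; have [mF Fk] := Foo k; have [mG Gk] := Goo k; split.
  apply: measurableI; rewrite -[X in measurable X]setTI.
  - exact: measurable_tnth.
  - exact: measurable_behead.
rewrite /lebesgue_cons /pushforward (_ : _ @^-1` _ = F k `*` G k).
  by rewrite product_measure1E//; apply: lte_mul_pinfty => //; rewrite ge0_fin_numE.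
apply/seteqP; split=> -[x t] /=; rewrite /hd /tl /pair_cons/= => -[Fx Gt].
- split=> //; move: Gt; congr (G k _).
  exact: val_inj.
- split=> //; move: Gt; congr (G k _); apply/esym.
  exact: val_inj.
Qed.

HB.instance Definition _ :=
  Measure_isSigmaFinite.Build _ _ _ lebesgue_cons lebesgue_cons_sigma_finite.
End lebesgue_tuple.

(* Lebesgue measure on R^n, as an iterated product of the one-dimensional one;
   [lebesgue_rV] transports it to row vectors. *)
Fixpoint lebesgue_tuple (R : realType) (n : nat) :
    {sigma_finite_measure set (n.-tuple (measurableTypeR R)) -> \bar R} :=
  match n with
  | 0 => \d_ ([tuple] : 0.-tuple (measurableTypeR R))
  | k.+1 => lebesgue_cons (lebesgue_tuple R k)
  end.

Section lebesgue_rV.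
Context {R : realType} {d : nat}.

Definition row_of_tuple (t : d.-tuple (measurableTypeR R)) : borel_rV R d :=
  (\row_i tnth t i : 'rV[R]_d).

Lemma measurable_row_of_tuple : measurable_fun [set: _] row_of_tuple.
Proof.
apply: (@measurability _ _ _ (borel_rV R d) _ _ (@open 'rV[R]_d) erefl).
move=> _ [U oU <-]; rewrite setTI.
pose box (q : {ffun 'I_d -> rat * rat}) : set (d.-tuple (measurableTypeR R)) :=
  \bigcap_(i in [set: 'I_d])
    (@tnth d (measurableTypeR R) ^~ i @^-1` `](ratr (q i).1), (ratr (q i).2)[%classic).
pose I := [set q : {ffun 'I_d -> rat * rat} | box q `<=` row_of_tuple @^-1` U].
rewrite (_ : _ @^-1` U = \bigcup_(q in I) box q); last first.
  apply/seteqP; split=> [t Ut|t [q Iq qt]]; last exact: Iq.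
  have /= [P Pt PU] : nbhs (row_of_tuple t : 'rV[R]_d) U by exact: open_nbhs_nbhs.
  have H i : {ab : rat * rat | (ratr ab.1 < (tnth t i : R) < ratr ab.2) /\
      `]ratr ab.1, ratr ab.2[%classic `<=` P ord0 i}.
    apply: cid; have := Pt ord0 i; rewrite mxE -nbhs_ballE => -[e /= e0 eP].
    have lt1 : (tnth t i : R) - e < tnth t i by rewrite ltrBlDr ltrDl.
    have lt2 : (tnth t i : R) < tnth t i + e by rewrite ltrDl.
    have [a] := rat_in_itvoo lt1; rewrite in_itv/= => /andP[a1 a2].
    have [b] := rat_in_itvoo lt2; rewrite in_itv/= => /andP[b1 b2].
    exists (a, b) => /=; split; first by rewrite a2.
    move=> y /=; rewrite in_itv/= => /andP[ay yb]; apply: eP.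
    rewrite /ball/= ltr_distlC; apply/andP; split; first exact: lt_trans ay.
    by exact: lt_trans yb _.
  exists [ffun i => sval (H i)] => /=.
    move=> s /= bs; apply: PU => i j; rewrite (ord1 i) mxE.
    by case: (H j) (bs j Logic.I) => /= ab [_ abP]; rewrite ffunE/=; case: (H j) => ? [_ +] /=; apply.
  by move=> i _; rewrite /= ffunE; case: (H i) => ? [].
rewrite bigcup_mkcond; apply: countable_bigcupT_measurable => [//|q].
case: ifPn => // _; apply: fin_bigcap_measurable.
  exact: (@finite_finset 'I_d).
move=> i _; rewrite -[X in measurable X]setTI.
by apply: measurable_tnth => //; exact: measurable_itv.
Qed.

Definition lebesgue_rV : set (borel_rV R d) -> \bar R :=
  pushforward (lebesgue_tuple R d) row_of_tuple.

Let lebesgue_rV0 : lebesgue_rV set0 = 0%E.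
Proof. exact: (measure0 (pushforward_measure _ measurable_row_of_tuple)). Qed.

Let lebesgue_rV_ge0 A : (0 <= lebesgue_rV A)%E.
Proof. exact: (measure_ge0 (pushforward_measure _ measurable_row_of_tuple)). Qed.

Let lebesgue_rV_sigma_additive : semi_sigma_additive lebesgue_rV.
Proof.
exact: (@measure_semi_sigma_additive _ _ _
  (pushforward_measure _ measurable_row_of_tuple)).
Qed.

HB.instance Definition _ := isMeasure.Build _ _ _ lebesgue_rV
  lebesgue_rV0 lebesgue_rV_ge0 lebesgue_rV_sigma_additive.

End lebesgue_rV.

Section function_spaces.
Context {R : realType} {d : nat}.
Implicit Types (mu : {measure set (borel_rV R d) -> \bar R}).
Implicit Types (D : set 'rV[R]_d) (V : set ('rV[R]_d -> R[i])).
Implicit Types (f g : 'rV[R]_d -> R[i]) (u : 'rV[R]_d -> R).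

Definition msupport mu : set 'rV[R]_d :=
  [set x | forall U, open U -> U x -> (0 < mu U)%E].

(* A function on D is encoded by its extension by 0 to R^d, so that equality
   of two such functions is pointwise equality on D. *)
Definition L2_on mu D f : Prop :=
  [/\ forall x, ~ D x -> f x = 0,
      measurable_fun [set: borel_rV R d] (fun x => complex.Re (f x)),
      measurable_fun [set: borel_rV R d] (fun x => complex.Im (f x)) &
      (\int[mu]_x (Normc.normc (f x) ^+ 2)%:E < +oo)%E].

Definition L2_inner mu f g : R[i] :=
  Complex (Rintegral mu setT (fun x => complex.Re (f x * conjc (g x))))
          (Rintegral mu setT (fun x => complex.Im (f x * conjc (g x)))).

(* Consequently V is a subspace of L^2_mu(D) and N = dim V. *)
Definition orthonormal_basis mu D V (N : nat) (v : 'I_N -> 'rV[R]_d -> R[i]) :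
    Prop :=
  [/\ forall i, L2_on mu D (v i),
      forall i j, L2_inner mu (v i) (v j) = (i == j)%:R &
      V = [set f | exists c : 'I_N -> R[i],
                     f = fun x => \sum_(i < N) c i * v i x]].

Definition kernel_diag N (v : 'I_N -> 'rV[R]_d -> R[i]) (x : 'rV[R]_d) : R :=
  \sum_(i < N) Normc.normc (v i x) ^+ 2.

Definition kernel_sup D N (v : 'I_N -> 'rV[R]_d -> R[i]) : \bar R :=
  ereal_sup [set (kernel_diag v x)%:E | x in D].

Definition q_star D (N : nat -> nat)
    (v : forall n, 'I_(N n) -> 'rV[R]_d -> R[i]) : \bar R :=
  limn_esup (fun n => lne (kernel_sup D (v n)) / (ln (N n)%:R)%:E)%E.

Definition induced_measure mu N (v : 'I_N -> 'rV[R]_d -> R[i])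
    (A : set (borel_rV R d)) : \bar R :=
  (\int[mu]_(x in A) (N%:R^-1 * kernel_diag v x)%:E)%E.

End function_spaces.

Section gradients.
Context {R : realType} {d : nat}.
Implicit Types (D : set 'rV[R]_d) (f : 'rV[R]_d -> R[i]) (u : 'rV[R]_d -> R).

Definition enorm (x : 'rV[R]_d) : R := Num.sqrt (\sum_(i < d) x ord0 i ^+ 2).

Definition eball (x : 'rV[R]_d) (r : R) : set 'rV[R]_d :=
  [set y | enorm (y - x) <= r].

(* Differentiability relative to D, so that boundary points of D are covered;
   at y = x the quotient is 0 / 0 = 0. *)
Definition is_grad D u (x g : 'rV[R]_d) : Prop :=
  (fun y => `|u y - u x - \sum_(i < d) g ord0 i * (y - x) ord0 i| /
            enorm (y - x)) @ within D (nbhs x) --> (0 : R).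

(* When D is convex with non-empty interior, the relative gradient at a point
   of D is unique. *)
Definition grad D u (x : 'rV[R]_d) : 'rV[R]_d := xget 0 [set g | is_grad D u x g].

Definition C1_on D u : Prop :=
  (forall x, D x -> exists g, is_grad D u x g) /\
  forall i, {within D, continuous (fun x => grad D u x ord0 i)}.

Definition C2_on D u : Prop :=
  C1_on D u /\ forall i, C1_on D (fun x => grad D u x ord0 i).

Definition complex_C2_on D f : Prop :=
  C2_on D (fun x => complex.Re (f x)) /\ C2_on D (fun x => complex.Im (f x)).

(* The squared norm of the complex gradient:
   |d_j f|^2 = (d_j Re f)^2 + (d_j Im f)^2 for every coordinate j. *)
Definition grad_sqnorm D f (x : 'rV[R]_d) : R :=
  enorm (grad D (fun y => complex.Re (f y)) x) ^+ 2 +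
  enorm (grad D (fun y => complex.Im (f y)) x) ^+ 2.

Definition grad_norm D N (v : 'I_N -> 'rV[R]_d -> R[i]) (x : 'rV[R]_d) : R :=
  Num.sqrt (\sum_(i < N) grad_sqnorm D (v i) x).

Definition grad_norm_max D N (v : 'I_N -> 'rV[R]_d -> R[i]) : R :=
  sup [set grad_norm D v x | x in D].

Definition grad_measure D N (v : 'I_N -> 'rV[R]_d -> R[i])
    (A : set (borel_rV R d)) : \bar R :=
  ((\int[lebesgue_rV]_(x in A `&` D) (grad_norm D v x ^+ d)%:E) /
   (\int[lebesgue_rV]_(y in D) (grad_norm D v y ^+ d)%:E))%E.

End gradients.

(* For D convex and compact and f continuous and positive, every [sup] and
   [inf] below is attained, so that it is a maximum or a minimum. *)
Section weighted_coverings.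
Context {R : realType} {d : nat}.
Variables (D : set 'rV[R]_d) (f : 'rV[R]_d -> R) (eps : R).

Definition relative_min (r : R) (y : 'rV[R]_d) : R :=
  inf [set f z | z in eball y r `&` D] / inf [set f z | z in D].

Definition cover_radius (y : 'rV[R]_d) : R :=
  sup [set Num.min (eps * relative_min c y) c | c in [set c | 0 <= c]].

Definition weighted_covering (A : {fset 'rV[R]_d}) : Prop :=
  [set` A] `<=` D /\
  exists rad : 'rV[R]_d -> R,
    (forall y, y \in A -> 0 <= rad y <= cover_radius y) /\
    D `<=` \bigcup_(y in [set` A]) eball y (rad y).

Definition distortion (A : {fset 'rV[R]_d}) : R :=
  \big[Num.max/0]_(y <- A)
    (sup [set f x | x in eball y (cover_radius y) `&` D] /
     inf [set f x | x in eball y (cover_radius y) `&` D]) ^+ d.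

Definition covering_cost : \bar R :=
  ereal_inf [set (#|` A|%:R * distortion A)%:E | A in weighted_covering].

End weighted_coverings.

Definition p_star {R : realType} {d : nat} (D : set 'rV[R]_d) (N : nat -> nat)
    (v : forall n, 'I_(N n) -> 'rV[R]_d -> R[i]) : \bar R :=
  limn_esup (fun n =>
    lne (covering_cost D (fun x => (grad_norm D (v n) x)^-1)%R
                         ((3 * grad_norm_max D (v n))^-1)%R)
    / (ln (N n)%:R)%:E)%E.

Definition iid_samples {R : realType} {d : nat} {disp : measure_display}
    {Om : measurableType disp} (P : probability Om R)
    (rho : set (borel_rV R d) -> \bar R) (m : nat)
    (X : 'I_m -> {RV P >-> borel_rV R d}) : Prop :=
  (forall k (A : set (borel_rV R d)), measurable A ->
     distribution P (X k) A = rho A) /\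
  (forall A : 'I_m -> set (borel_rV R d), (forall k, measurable (A k)) ->
     P (\bigcap_k (X k @^-1` A k)) = \prod_(k < m) P (X k @^-1` A k))%E.

(* The A_n form an asymptotic WAM with exponents a and b (an asymptotic AM when
   b = 0). Here m n is |A_n| and A_n = {X n k w | k < m n} for the
   realization w. The m n samples of each A_n are i.i.d.; nothing is assumed
   about the joint law of A_n and A_n' for n <> n'. *)
Definition random_admissible_mesh {R : realType} {d : nat} (D : set 'rV[R]_d)
    (V : nat -> set ('rV[R]_d -> R[i])) (N : nat -> nat)
    (rho : nat -> set (borel_rV R d) -> \bar R) (a b : R) : Prop :=
  exists (m : nat -> nat) (ka : R),
  forall (disp : measure_display) (Om : measurableType disp)
    (P : probability Om R) (X : forall n, 'I_(m n) -> {RV P >-> borel_rV R d}),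
  (forall n, iid_samples (rho n) (X n)) ->
  {ae P, forall w, exists (kb : R) (n0 : nat), forall n, (n0 <= n)%N ->
    (forall f, V n f ->
       ereal_sup [set (Normc.normc (f x))%:E | x in D] <=
       (kb * (N n)%:R `^ b *
        \big[Num.max/0]_(k < m n) Normc.normc (f (X n k w)))%:E)%E /\
    (m n)%:R <= ka * (N n)%:R `^ a}.

(* Main.v *)
(** Items 1 and 2 avoid matrix concentration. For [f = sum_i c_i v_i] in [V_n],
    a sample point [x] acts on the coefficients by the (weighted, complex)
    Kaczmarz step [Q_x c = c - s(x) f(x) conj(v(x))]. With [s(x) K(x,x) <= 1] one
    has [|Q_x c|^2 + s(x) |f(x)|^2 <= |c|^2], and if the expectation of
    [s |f|^2] under the sampling measure is at least [t |c|^2], then independence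
    gives [E |Q_(x_m) ... Q_(x_1) e_i|^2 <= (1 - t)^m]. By Markov's inequality the
    product of the steps has norm at most 1/2, outside an event of probability at
    most [4 N (1 - t)^m]; telescoping [c] along the orbit then yields
    [|c|^2 <= 4 sum_k s(x_k) |f(x_k)|^2]. Item 1 takes [s = t = N^-(q + eps/2)],
    item 2 takes [s(x) = 1 / K(x,x)] and [t = 1 / N], with [m] larger than [1 / t]
    by a power of [N], and Borel-Cantelli concludes.

    For item 3, let [r] be the covering radius at a centre [y] of a nearly optimal
    covering. Then [R_n <= 1 / (3 r)] on the ball [B_r(y)], with equality somewhere
    in the ball, so that every ball has [nu_n]-measure at least
    [c / (|covering| G)], and all balls are hit once
    [m] exceeds [|covering| G] by a power of [N]. The gradient of a function [f] of
    [V_n] is at most [|f|_2 R_n <= |f|_oo R_n], hence [f] oscillates by at most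
    [2/3 |f|_oo] on each of these balls and [|f|_oo <= 3 max_k |f(x_k)|]. *)

Require Import Defs.
From HB Require Import structures.
From mathcomp Require Import all_boot all_order all_algebra finmap.
From mathcomp Require Import complex.
From mathcomp Require Import all_classical all_reals all_analysis.
From mathcomp Require Import measurable_realfun.
From mathcomp Require Import ring lra.
Import Order.TTheory GRing.Theory Num.Theory.
Import numFieldNormedType.Exports.
Local Open Scope classical_set_scope.
Local Open Scope ring_scope.
Set Implicit Arguments.
Unset Strict Implicit.
Unset Printing Implicit Defensive.

(** * Kaczmarz steps *)

Section kaczmarz.
Context {R : realType} {T : Type} {N : nat}.
Implicit Types (c h : 'I_N -> R[i]).
Variables (v : 'I_N -> T -> R[i]) (s : T -> R).

(** The norm of a random product of steps is a supremum over uncountably many coefficient vectors.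
    By linearity it is dominated by the Hilbert-Schmidt norm, that is, by the orbits of the N basis
    vectors; this costs a factor N, harmless because (1 - t)^m decays faster than every power of N.
    The same decay gives summability over n, since strict growth of the dimensions forces N_n >= n +
    1, and the convergence half of Borel-Cantelli asks nothing about the joint law of different
    levels. The exponent b comes from |f|_oo^2 <= K |c|^2 <= 4 K sigma m max_k |f(x_k)|^2, where
    sigma bounds the weight s. In item 1, K sigma <= 1 and only m is left. In item 2, the constant
    in V_0 gives K(x,x) >= 1 on D, so that sigma = 1 and K m is left. In item 3 the sup norms are
    compared directly, without passing through K, so no power of N is lost. *)

Definition sqnorm c : R := \sum_(i < N) Normc.normc (c i) ^+ 2.

Definition lincomb c (x : T) : R[i] := \sum_(i < N) c i * v i x.

(** Damped projection towards the coefficient vectors whose function vanishes at [x]; it is the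
    orthogonal projection when [s x] is the inverse of [sqnorm (v^~ x)]. *)
Definition kaczmarz_step (x : T) c : 'I_N -> R[i] :=
  fun i => c i - real_complex R (s x) * lincomb c x * conjc (v i x).

Fixpoint kaczmarz (y : nat -> T) (m : nat) c : 'I_N -> R[i] :=
  if m is k.+1 then kaczmarz_step (y k) (kaczmarz y k c) else c.

Lemma sqr_normcE (z : R[i]) :
  Normc.normc z ^+ 2 = complex.Re z ^+ 2 + complex.Im z ^+ 2.
Proof. by case: z => a b /=; rewrite sqr_sqrtr// addr_ge0 ?sqr_ge0. Qed.

Lemma Re_sum (I : Type) (r : seq I) (F : I -> R[i]) :
  complex.Re (\sum_(i <- r) F i) = \sum_(i <- r) complex.Re (F i).
Proof. by elim/big_rec2: _ => // i x z _ <-; case: (F i); case: z. Qed.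

Lemma sqnorm_ge0 c : 0 <= sqnorm c.
Proof. by apply: sumr_ge0 => i _; exact: sqr_ge0. Qed.

Lemma Re_conj_mul (z : R[i]) : complex.Re (conjc z * z) = Normc.normc z ^+ 2.
Proof. by rewrite sqr_normcE; case: z => a b /=; ring. Qed.

Lemma Re_conj_mul_le (a b : R[i]) :
  complex.Re (conjc a * b) <= Normc.normc a ^+ 2 / 4 + Normc.normc b ^+ 2.
Proof.
rewrite !sqr_normcE; move: a b => [a a'] [b b'] /=.
have := sqr_ge0 (a / 2 - b); have := sqr_ge0 (a' / 2 - b'); nra.
Qed.

Lemma sqnorm_kaczmarz_step x c :
  sqnorm (kaczmarz_step x c) = sqnorm c -
    (2 * s x - s x ^+ 2 * sqnorm (v^~ x)) * Normc.normc (lincomb c x) ^+ 2.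
Proof.
set f := lincomb c x.
have E i : Normc.normc (kaczmarz_step x c i) ^+ 2 = Normc.normc (c i) ^+ 2 -
    2 * s x * complex.Re (conjc f * (c i * v i x)) +
    s x ^+ 2 * Normc.normc f ^+ 2 * Normc.normc (v i x) ^+ 2.
  rewrite /kaczmarz_step -/f !sqr_normcE.
  by move: f (c i) (v i x) => [f f'] [a a'] [b b'] /=; ring.
rewrite /sqnorm (eq_bigr _ (fun i _ => E i)) big_split sumrB /=.
rewrite -!mulr_sumr -Re_sum -mulr_sumr -/(lincomb c x) -/f.
rewrite -/(sqnorm (v^~ x)).
rewrite Re_conj_mul; ring.
Qed.

Hypothesis s_ge0 : forall x, 0 <= s x.
Hypothesis s_le : forall x, s x * sqnorm (v^~ x) <= 1.

Lemma sqnorm_kaczmarz_step_le x c :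
  sqnorm (kaczmarz_step x c) + s x * Normc.normc (lincomb c x) ^+ 2 <= sqnorm c.
Proof.
rewrite sqnorm_kaczmarz_step -subr_ge0.
set k := sqnorm (v^~ x); set F := Normc.normc _ ^+ 2.
rewrite (_ : _ - _ = s x * (1 - s x * k) * F); last by ring.
apply: mulr_ge0; last exact: sqr_ge0.
by apply: mulr_ge0 => //; rewrite subr_ge0; exact: s_le.
Qed.

Lemma kaczmarz_energy y m c :
  sqnorm (kaczmarz y m c) +
    \sum_(k < m) s (y k) * Normc.normc (lincomb (kaczmarz y k c) (y k)) ^+ 2
  <= sqnorm c.
Proof.
elim: m => [|m IH] /=; first by rewrite big_ord0 addr0.
rewrite big_ord_recr/=; apply: le_trans IH.
have := sqnorm_kaczmarz_step_le (y m) (kaczmarz y m c).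
lra.
Qed.

(* Expanding [c] along the orbit leaves only the terms [s_k conj(f_k) f_c]
   evaluated at the points; the [f_k] are absorbed by the energy identity. *)
Lemma kaczmarz_frame y m c :
  sqnorm (kaczmarz y m c) <= sqnorm c / 4 ->
  sqnorm c <= 4 * \sum_(k < m) s (y k) * Normc.normc (lincomb c (y k)) ^+ 2.
Proof.
pose ip h := \sum_(i < N) complex.Re (conjc (h i) * c i).
have ipS x h : ip (kaczmarz_step x h) =
    ip h - s x * complex.Re (conjc (lincomb h x) * lincomb c x).
  have E i : complex.Re (conjc (kaczmarz_step x h i) * c i) =
      complex.Re (conjc (h i) * c i) -
      s x * complex.Re (conjc (lincomb h x) * (c i * v i x)).
    rewrite /kaczmarz_step.
    by move: (lincomb h x) (h i) (c i) (v i x) => [f f'] [h1 h2] [a a'] [b b'] /=;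
      ring.
  by rewrite /ip (eq_bigr _ (fun i _ => E i)) sumrB -mulr_sumr -[X in _ - _ * X]Re_sum -mulr_sumr.
have ipE : ip (kaczmarz y m c) = ip c - \sum_(k < m) s (y k) *
    complex.Re (conjc (lincomb (kaczmarz y k c) (y k)) * lincomb c (y k)).
  elim: m => [|m IH] /=; first by rewrite big_ord0 subr0.
  by rewrite ipS IH big_ord_recr/= opprD addrA.
have ipcc : ip c = sqnorm c.
  by apply: eq_bigr => i _; rewrite Re_conj_mul.
have ip_le : ip (kaczmarz y m c) <= sqnorm (kaczmarz y m c) + sqnorm c / 4.
  rewrite /ip /sqnorm mulr_suml -big_split /=; apply: ler_sum => i _.
  rewrite addrC; apply: le_trans (Re_conj_mul_le (c i) _).
  by rewrite le_eqVlt; apply/orP; left; move: (c i) (kaczmarz _ _ _ _) => [a a'] [b b'] /=;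
    apply/eqP; ring.
move=> small; have en := kaczmarz_energy y m c.
have : \sum_(k < m) s (y k) *
    complex.Re (conjc (lincomb (kaczmarz y k c) (y k)) * lincomb c (y k)) <=
    (\sum_(k < m) s (y k) * Normc.normc (lincomb (kaczmarz y k c) (y k)) ^+ 2) / 4 +
    \sum_(k < m) s (y k) * Normc.normc (lincomb c (y k)) ^+ 2.
  rewrite mulr_suml -big_split /=; apply: ler_sum => k _.
  by rewrite -mulrA -mulrDr; apply: ler_wpM2l => //; exact: Re_conj_mul_le.
(* Three terms of size at most [sqnorm c / 4] are absorbed: the final vector, the remainder in
   [ip_le], and a quarter of the energy sum, which [en] bounds by [sqnorm c]. The quarter left over
   gives the factor 4. *)
move: ip_le; rewrite ipE ipcc; move: small en (sqnorm_ge0 (kaczmarz y m c)).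
lra.
Qed.

Definition basis_vec (j : 'I_N) : 'I_N -> R[i] := fun i => (i == j)%:R.

Lemma kaczmarzE y m c i :
  kaczmarz y m c i = \sum_(j < N) c j * kaczmarz y m (basis_vec j) i.
Proof.
elim: m i => [|m IH] i /=.
  rewrite (bigD1 i)//= /basis_vec eqxx mulr1 big1 ?addr0// => j ji.
  by rewrite eq_sym (negbTE ji) mulr0.
rewrite /kaczmarz_step IH.
under [RHS]eq_bigr do rewrite mulrBr.
rewrite sumrB; congr (_ - _).
have -> : lincomb (kaczmarz y m c) (y m) =
    \sum_j c j * lincomb (kaczmarz y m (basis_vec j)) (y m).
  rewrite /lincomb; under eq_bigr do rewrite IH mulr_suml.
  rewrite exchange_big/=; apply: eq_bigr => j _; rewrite mulr_sumr.
  by apply: eq_bigr => k _; rewrite mulrA.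
by rewrite mulr_sumr mulr_suml; apply: eq_bigr => j _; rewrite mulrCA !mulrA.
Qed.

Lemma CauchySchwarz_sum (a b : 'I_N -> R) :
  (\sum_i a i * b i) ^+ 2 <= (\sum_i a i ^+ 2) * (\sum_i b i ^+ 2).
Proof.
set A := \sum_i a i ^+ 2; set B := \sum_i b i ^+ 2; set C := \sum_i _.
have A0 : 0 <= A by apply: sumr_ge0 => i _; exact: sqr_ge0.
have B0 : 0 <= B by apply: sumr_ge0 => i _; exact: sqr_ge0.
have H t : 0 <= A - 2 * t * C + t ^+ 2 * B.
  rewrite (_ : _ + _ = \sum_i (a i - t * b i) ^+ 2).
    by apply: sumr_ge0 => i _; exact: sqr_ge0.
  rewrite /A /B /C 2!mulr_sumr -sumrB -big_split/=.
  by apply: eq_bigr => i _; ring.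
have [B00|B00] := eqVneq B 0.
  have [->|C0] := eqVneq C 0; first by rewrite expr0n mulr_ge0.
  (* For [B = 0] the form is affine in [t]; this [t] would make it -1. *)
  have := H ((A + 1) / (2 * C)); rewrite B00 mulr0 addr0.
  rewrite (_ : 2 * _ * C = A + 1); last by field.
  by lra.
have Bp : 0 < B by rewrite lt_neqAle eq_sym B00.
have := H (C / B); rewrite (_ : _ + _ = (A * B - C ^+ 2) / B); last by field.
by rewrite pmulr_lge0 ?invr_gt0// subr_ge0.
Qed.

Lemma normc_sum_le (I : Type) (r : seq I) (F : I -> R[i]) :
  Normc.normc (\sum_(i <- r) F i) <= \sum_(i <- r) Normc.normc (F i).
Proof.
elim/big_rec2: _ => [|i x z _ h]; first by rewrite Normc.normc0.
by rewrite (le_trans (le_normcD _ _))// lerD2l.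
Qed.

Lemma normc_ge0 (z : R[i]) : 0 <= Normc.normc z.
Proof. by case: z => a b; exact: sqrtr_ge0. Qed.

Lemma normc_sum_mul_sqr_le (c h : 'I_N -> R[i]) :
  Normc.normc (\sum_i c i * h i) ^+ 2 <= sqnorm c * sqnorm h.
Proof.
apply: le_trans (CauchySchwarz_sum (fun i => Normc.normc (c i)) (fun i => Normc.normc (h i))).
rewrite lerXn2r ?nnegrE ?normc_ge0//=.
  by apply: sumr_ge0 => i _; rewrite mulr_ge0 ?normc_ge0.
apply: le_trans (normc_sum_le _ _) _.
by apply: ler_sum => i _; rewrite Normc.normcM.
Qed.

(** Cauchy-Schwarz in the expansion [kaczmarzE]. The sum on the right is a squared Hilbert-Schmidt
    norm and does not depend on [c]. *)
Lemma sqnorm_kaczmarz_le y m c :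
  sqnorm (kaczmarz y m c) <=
  sqnorm c * \sum_(j < N) sqnorm (kaczmarz y m (basis_vec j)).
Proof.
rewrite [X in X <= _]/sqnorm [in leRHS]/sqnorm exchange_big/= mulr_sumr.
apply: ler_sum => i _; rewrite kaczmarzE.
exact: normc_sum_mul_sqr_le.
Qed.

Lemma sqnorm_basis_vec j : sqnorm (basis_vec j) = 1.
Proof.
rewrite /sqnorm (bigD1 j)//= /basis_vec eqxx Normc.normc1 expr1n big1 ?addr0//.
by move=> i ij; rewrite (negbTE ij) Normc.normc0 expr0n.
Qed.

End kaczmarz.

(** * Independence *)

Section past_sigma_algebra.
Context {R : realType} {dT dO : measure_display} {T : measurableType dT}
  {Om : measurableType dO} {P : probability Om R} {m : nat}.
Variable X : 'I_m -> {RV P >-> T}.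

(** Rectangles in the first [k] samples: a pi-system generating the sigma-algebra of the past.
    Keeping the index type ['I_m] and ignoring [A j] for [j >= k] avoids casts between index
    types. *)
Definition past (k : nat) : set (set Om) :=
  [set E | exists2 A : 'I_m -> set T, (forall j, measurable (A j)) &
     E = \bigcap_(j in [set j : 'I_m | (j < k)%N]) (X j @^-1` A j)].

Hypothesis X_indep : forall A : 'I_m -> set T, (forall k, measurable (A k)) ->
  (P (\bigcap_k (X k @^-1` A k)) = \prod_(k < m) P (X k @^-1` A k))%E.

Lemma measurable_preimage_RV (j : 'I_m) A : measurable A -> measurable (X j @^-1` A).
Proof. by move=> mA; rewrite -[_ @^-1` _]setTI; exact: measurable_funPT. Qed.

Lemma past_measurable k : past k `<=` measurable.
Proof.
move=> _ [A mA ->]; apply: fin_bigcap_measurable; first exact: finite_finset.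
by move=> j _; exact: measurable_preimage_RV.
Qed.

Lemma past_setI_closed k : setI_closed (past k).
Proof.
move=> _ _ [A mA ->] [B mB ->]; exists (fun j => A j `&` B j).
  by move=> j; exact: measurableI.
by rewrite -bigcapI.
Qed.

Lemma past_setT k : past k setT.
Proof. by exists (fun=> setT) => //; apply/seteqP; split. Qed.

Lemma sigma_past_measurable k : <<s past k >> `<=` measurable.
Proof. by apply: smallest_sub; [exact: sigma_algebra_measurable|exact: past_measurable]. Qed.

(** Dynkin's uniqueness argument: as functions of [E], both sides are finite measures, and on the
    pi-system of rectangles they agree by the product formula. *)
Lemma past_indep (k : 'I_m) (B : set T) E : measurable B ->
  <<s past k >> E -> (P (E `&` X k @^-1` B) = P E * P (X k @^-1` B))%E.
Proof.
move=> mB; have mC := measurable_preimage_RV k mB.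
set C := X k @^-1` B in mC *.
have PCge0 : 0 <= fine (P C) by exact: fine_ge0.
pose m2 : {measure set Om -> \bar R} := mscale (NngNum PCge0) P.
have m2E A : (m2 A = P A * P C)%E.
  by rewrite /m2 /= /mscale/= fineK ?fin_num_measure// muleC.
rewrite -m2E.
apply: (@g_sigma_algebra_measure_unique _ _ _ (past k) _ (fun=> setT) _ _
  (mrestr P mC) m2).
- exact: past_measurable.
- by move=> _; exact: past_setT.
- by rewrite bigcup_const.
- exact: past_setI_closed.
- move=> _ [A mA ->]; rewrite m2E /= /mrestr.
  (* [X_indep] speaks of all [m] samples at once, so the rectangle is filled up with [setT]; [A1]
     and [A0] differ only in coordinate [k], where [A0] contributes the factor 1. *)
  pose A1 (j : 'I_m) := if (j < k)%N then A j else if j == k then B else setT.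
  pose A0 (j : 'I_m) := if (j < k)%N then A j else setT.
  have -> : \bigcap_(j in [set j : 'I_m | (j < k)%N]) (X j @^-1` A j) `&` C =
      \bigcap_j (X j @^-1` A1 j).
    apply/seteqP; split=> [w [wA wC] j _|w wA].
      rewrite /A1/=; case: ifPn => jk; first exact: wA.
      by case: eqP => // ->.
    split=> [j jk|]; first by have := wA j I; rewrite /= /A1 jk.
    by have := wA k I; rewrite /= /A1 ltnn eqxx.
  have -> : \bigcap_(j in [set j : 'I_m | (j < k)%N]) (X j @^-1` A j) =
      \bigcap_j (X j @^-1` A0 j).
    apply/seteqP; split=> [w wA j _|w wA j jk].
      by rewrite /A0/=; case: ifPn => jk //; exact: wA.
    by have := wA j I; rewrite /= /A0 jk.
  rewrite !X_indep; first last.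
  + by move=> j; rewrite /A1; case: ifP => // _; case: ifP.
  + by move=> j; rewrite /A0; case: ifP.
  rewrite (bigD1 k)//= [in RHS](bigD1 k)//=.
  rewrite {1}/A1 {1}/A0 ltnn eqxx preimage_setT probability_setT mul1e muleC.
  congr (_ * _)%E; apply: eq_bigr => j /negbTE jk.
  by rewrite /A1 /A0 jk.
- move=> _ /=; rewrite /mrestr (le_lt_trans (probability_le1 _ _)) ?ltry//.
  exact: measurableI.
Qed.

Definition past_space k : measurableType (past k).-sigma :=
  g_sigma_algebraType (past k).
Local Notation S := past_space.

Lemma past_id_measurable k : measurable_fun [set: Om] (id : Om -> S k).
Proof. by move=> _ A mA; rewrite setTI; exact: (@sigma_past_measurable k A mA). Qed.

Lemma past_RV_measurable k (j : 'I_m) : (j < k)%N ->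
  measurable_fun [set: S k] (X j : S k -> T).
Proof.
move=> jk _ A mA; rewrite setTI; apply: sub_sigma_algebra.
exists (fun i => if i == j then A else setT).
  by move=> i; case: ifP.
apply/seteqP; split=> [w wA i _|w]; first by case: eqP => // ->.
by move=> /(_ j jk); rewrite eqxx.
Qed.

(** This stands in for conditional expectation: the pair of the past and [X k] has a product law by
    [past_indep], and Tonelli integrates out [X k] with the past frozen. *)
Lemma expectation_indep (k : 'I_m) (F : S k * T -> \bar R) :
  measurable_fun [set: S k * T] F -> (forall z, 0 <= F z)%E ->
  (\int[P]_w F (w, X k w) = \int[P]_w \int[distribution P (X k)]_x F (w, x))%E.
Proof.
move=> mF F0.
(* The identity of [Om], read as a random variable into the coarser space of the past. *)
pose iS := [the Om -> S k of id].
have miS : measurable_fun [set: Om] iS := @past_id_measurable k.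
pose iM : {RV P >-> S k} := HB.pack iS (isMeasurableFun.Build _ _ _ _ _ miS).
have mpr : measurable_fun [set: Om] (fun w : Om => (iS w, X k w)).
  by apply: measurable_fun_pair => //; exact: measurable_funPT.
pose pr : {RV P >-> (S k * T)%type} :=
  HB.pack (fun w : Om => (iS w, X k w)) (isMeasurableFun.Build _ _ _ _ _ mpr).
transitivity (\int[distribution P pr]_z F z)%E.
  by rewrite ge0_integral_distribution.
rewrite (eq_measure_integral (distribution P iM \x distribution P (X k))%E); last first.
  move=> A mA _; apply/esym; apply: (@product_measure_unique _ _ _ _ _
    (distribution P iM) (distribution P (X k)) (distribution P pr)) => //.
  move=> E B mE mB; rewrite /distribution /pushforward/=.
  exact: past_indep.
rewrite fubini_tonelli1//= ge0_integral_distribution//.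
- exact: measurable_fun_fubini_tonelli_F.
- by move=> w; apply: integral_ge0.
Qed.

End past_sigma_algebra.

(** * Measurability of complex-valued functions *)

Section complex_measurable.
Context {R : realType} {d : measure_display} {T : measurableType d}.
Implicit Types f g : T -> R[i].

Definition cmeasurable f : Prop :=
  measurable_fun setT (@complex.Re R \o f) /\ measurable_fun setT (@complex.Im R \o f).

Lemma cmeasurable_cst (z : R[i]) : cmeasurable (fun=> z).
Proof. by split; exact: measurable_cst. Qed.

Lemma cmeasurableD f g : cmeasurable f -> cmeasurable g ->
  cmeasurable (fun x => f x + g x).
Proof.
move=> [fr fi] [gr gi]; split.
- rewrite (_ : _ \o _ = (@complex.Re R \o f) \+ (@complex.Re R \o g)).
    exact: measurable_funD.
  by apply/funext => x /=; case: (f x) (g x) => ? ? [].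
- rewrite (_ : _ \o _ = (@complex.Im R \o f) \+ (@complex.Im R \o g)).
    exact: measurable_funD.
  by apply/funext => x /=; case: (f x) (g x) => ? ? [].
Qed.

Lemma cmeasurableN f : cmeasurable f -> cmeasurable (fun x => - f x).
Proof.
move=> [fr fi]; split.
- rewrite (_ : _ \o _ = \- (@complex.Re R \o f)); first exact: measurable_funN.
  by apply/funext => x /=; case: (f x).
- rewrite (_ : _ \o _ = \- (@complex.Im R \o f)); first exact: measurable_funN.
  by apply/funext => x /=; case: (f x).
Qed.

Lemma cmeasurableM f g : cmeasurable f -> cmeasurable g ->
  cmeasurable (fun x => f x * g x).
Proof.
move=> [fr fi] [gr gi]; split.
- rewrite (_ : _ \o _ = ((@complex.Re R \o f) \* (@complex.Re R \o g)) \-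
     ((@complex.Im R \o f) \* (@complex.Im R \o g))).
    by apply: measurable_funB; exact: measurable_funM.
  by apply/funext => x /=; case: (f x) (g x) => ? ? [].
- rewrite (_ : _ \o _ = ((@complex.Re R \o f) \* (@complex.Im R \o g)) \+
     ((@complex.Im R \o f) \* (@complex.Re R \o g))).
    by apply: measurable_funD; exact: measurable_funM.
  by apply/funext => x /=; case: (f x) (g x) => ? ? [].
Qed.

Lemma cmeasurable_conj f : cmeasurable f -> cmeasurable (fun x => conjc (f x)).
Proof.
move=> [fr fi]; split.
- by rewrite (_ : _ \o _ = @complex.Re R \o f)//; apply/funext => x /=; case: (f x).
- rewrite (_ : _ \o _ = \- (@complex.Im R \o f)); first exact: measurable_funN.
  by apply/funext => x /=; case: (f x).
Qed.

Lemma cmeasurable_real (s : T -> R) : measurable_fun setT s ->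
  cmeasurable (fun x => real_complex R (s x)).
Proof. by move=> ms; split => //; exact: measurable_cst. Qed.

Lemma cmeasurable_sum n (F : 'I_n -> T -> R[i]) :
  (forall i, cmeasurable (F i)) -> cmeasurable (fun x => \sum_(i < n) F i x).
Proof.
move=> mF; rewrite (_ : (fun x => _) = \sum_(i < n) F i); last first.
  by apply/funext => x; rewrite fct_sumE.
elim/big_ind: _ => [|f g mf mg|//].
- exact: cmeasurable_cst.
- exact: (cmeasurableD mf mg).
Qed.

Lemma measurable_sqr_normc f : cmeasurable f ->
  measurable_fun setT (fun x => Normc.normc (f x) ^+ 2).
Proof.
move=> [fr fi]; under eq_fun do rewrite sqr_normcE.
by apply: measurable_funD; exact: measurable_funX.
Qed.

End complex_measurable.

Lemma cmeasurable_comp {R : realType} {d1 d2 : measure_display}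
    {T1 : measurableType d1} {T2 : measurableType d2}
    (f : T2 -> R[i]) (g : T1 -> T2) :
  cmeasurable f -> measurable_fun setT g -> cmeasurable (f \o g).
Proof.
by move=> [fr fi] mg; split; [exact: (measurableT_comp fr mg)|exact: (measurableT_comp fi mg)].
Qed.

(** * Expected contraction of random Kaczmarz products *)

Section random_kaczmarz.
Context {R : realType} {dT : measure_display} {T : measurableType dT} {N : nat}.
Variables (v : 'I_N -> T -> R[i]) (s : T -> R).
Hypothesis mv : forall i, cmeasurable (v i).
Hypothesis ms : measurable_fun setT s.
Hypothesis s_ge0 : forall x, 0 <= s x.
Hypothesis s_le : forall x, s x * sqnorm (v^~ x) <= 1.

Lemma measurable_sqnorm {d} {S : measurableType d} (h : S -> 'I_N -> R[i]) :
  (forall i, cmeasurable (h^~ i)) -> measurable_fun setT (sqnorm \o h).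
Proof.
move=> mh; rewrite (_ : _ \o _ = fun w => \sum_(i < N) Normc.normc (h w i) ^+ 2)//.
by apply: measurable_sum => i; exact: measurable_sqr_normc.
Qed.

Lemma lincomb_cmeasurable {d} {S : measurableType d} (x : S -> T)
    (h : S -> 'I_N -> R[i]) :
  measurable_fun setT x -> (forall i, cmeasurable (h^~ i)) ->
  cmeasurable (fun w => lincomb v (h w) (x w)).
Proof.
move=> mx mh; apply: cmeasurable_sum => i; apply: cmeasurableM => //.
exact: (cmeasurable_comp (mv i) mx).
Qed.

Lemma kaczmarz_step_cmeasurable {d} {S : measurableType d} (x : S -> T)
    (h : S -> 'I_N -> R[i]) i :
  measurable_fun setT x -> (forall i, cmeasurable (h^~ i)) ->
  cmeasurable (fun w => kaczmarz_step v s (x w) (h w) i).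
Proof.
move=> mx mh; apply: cmeasurableD => //; apply: cmeasurableN.
apply: cmeasurableM; first apply: cmeasurableM.
- by apply: cmeasurable_real; exact: measurableT_comp.
- exact: lincomb_cmeasurable.
- by apply: cmeasurable_conj; exact: (cmeasurable_comp (mv i) mx).
Qed.

Context {dO : measure_display} {Om : measurableType dO} {P : probability Om R}.
Context {m : nat}.
Variable X : 'I_m -> {RV P >-> T}.

(** Orbits run along sequences indexed by [nat]; the default [point] is never read, because only
    indices below [m] occur. *)
Definition samples (w : Om) (k : nat) : T :=
  if insub k is Some i then X i w else point.

Lemma samplesE w (k : 'I_m) : samples w k = X k w.
Proof. by rewrite /samples valK. Qed.

Hypothesis X_indep : forall A : 'I_m -> set T, (forall k, measurable (A k)) ->
  (P (\bigcap_k (X k @^-1` A k)) = \prod_(k < m) P (X k @^-1` A k))%E.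

(** An orbit of length [j] reads only the samples with index below [j]. Measurability for the past,
    stronger than measurability on [Om], is what makes the orbit independent of [X k]. *)
Lemma kaczmarz_past_cmeasurable k j c i : (j <= k)%N -> (k <= m)%N ->
  @cmeasurable R _ (past_space X k) (fun w => kaczmarz v s (samples w) j c i).
Proof.
elim: j i => [|j IH] i jk km /=; first exact: cmeasurable_cst.
apply: kaczmarz_step_cmeasurable => [|i']; last by apply: IH => //; exact: ltnW.
rewrite (_ : (fun w => _) = X (Ordinal (leq_trans jk km))).
  exact: past_RV_measurable.
by apply/funext => w; rewrite -[j]/(val (Ordinal (leq_trans jk km))) samplesE.
Qed.

Lemma kaczmarz_cmeasurable k c i : (k <= m)%N ->
  cmeasurable (fun w => kaczmarz v s (samples w) k c i).
Proof.
move=> km.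
exact: (cmeasurable_comp (kaczmarz_past_cmeasurable c i (leqnn k) km)
  (@past_id_measurable _ _ _ _ _ _ _ X k)).
Qed.

Variable t : R.
Hypothesis t01 : 0 <= t <= 1.
Hypothesis step_contract : forall (k : 'I_m) c,
  (\int[distribution P (X k)]_x (sqnorm (kaczmarz_step v s x c))%:E
   <= ((1 - t) * sqnorm c)%:E)%E.

(** The last sample is independent of the orbit before it, so integrating it out first applies
    [step_contract] to a frozen vector and gains one factor [1 - t]. *)
Lemma expectation_kaczmarz_le k c : (k <= m)%N ->
  (\int[P]_w (sqnorm (kaczmarz v s (samples w) k c))%:E <=
   ((1 - t) ^+ k * sqnorm c)%:E)%E.
Proof.
have t1 : 0 <= 1 - t by rewrite subr_ge0; case/andP: t01.
elim: k => [|k IH] km.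
  rewrite /= integral_cst// [X in (_ * X)%E](@probability_setT _ _ _ P) mule1.
  by rewrite expr0 mul1r.
pose ko := Ordinal km.
pose F (z : past_space X k * T) :=
  (sqnorm (kaczmarz_step v s z.2 (kaczmarz v s (samples z.1) k c)))%:E.
have mF : measurable_fun [set: past_space X k * T] F.
  apply/measurable_EFinP; apply: (@measurable_sqnorm _ (past_space X k * T)%type
    (fun z => kaczmarz_step v s z.2 (kaczmarz v s (samples z.1) k c))) => i.
  apply: (@kaczmarz_step_cmeasurable _ (past_space X k * T)%type snd
    (fun z => kaczmarz v s (samples z.1) k c)); first exact: measurable_snd.
  move=> i'; apply: (@cmeasurable_comp _ _ _ _ (past_space X k)
    (fun w => kaczmarz v s (samples w) k c i') fst).
    by apply: kaczmarz_past_cmeasurable => //; exact: ltnW.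
  exact: measurable_fst.
have -> : (\int[P]_w (sqnorm (kaczmarz v s (samples w) k.+1 c))%:E =
    \int[P]_w F (w, X ko w))%E.
  apply: eq_integral => w _; rewrite /F /=.
  by rewrite -[k]/(val ko) samplesE.
rewrite (expectation_indep X_indep)//; last first.
  by move=> z; rewrite lee_fin sqnorm_ge0.
apply: (@le_trans _ _ (\int[P]_w ((1 - t)%:E *
    (sqnorm (kaczmarz v s (samples w) k c))%:E))%E).
  apply: ge0_le_integral => //.
  - by move=> w _; apply: integral_ge0 => x _; rewrite lee_fin sqnorm_ge0.
  - have := @measurable_fun_fubini_tonelli_F _ _ _ _ _ (distribution P (X ko)) F mF.
    move=> /(_ (fun z => sqnorm_ge0 _)) mG.
    exact: (measurableT_comp mG (@past_id_measurable _ _ _ _ _ _ _ X k)).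
  - apply/measurable_EFinP; apply: measurable_funM => //.
    by apply: measurable_sqnorm => i; apply: kaczmarz_cmeasurable; exact: ltnW.
  - move=> w _; have := step_contract ko (kaczmarz v s (samples w) k c).
    by rewrite EFinM.
rewrite ge0_integralZl_EFin//; last 2 first.
- by move=> w _; rewrite lee_fin sqnorm_ge0.
- apply/measurable_EFinP; apply: measurable_sqnorm => i.
  by apply: kaczmarz_cmeasurable; exact: ltnW.
rewrite exprS -mulrA EFinM; apply: lee_wpmul2l; first by rewrite lee_fin.
by apply: IH; exact: ltnW.
Qed.

(** The threshold 1/4 is the smallness asked by [kaczmarz_frame]. The event does not mention [c], so
    its complement serves all functions of the space at once. *)
Definition kaczmarz_bad : set Om :=
  [set w | 1 / 4 < \sum_(j < N) sqnorm (kaczmarz v s (samples w) m (basis_vec j))].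

Lemma measurable_kaczmarz_sum : measurable_fun setT
  (fun w => \sum_(j < N) sqnorm (kaczmarz v s (samples w) m (basis_vec j))).
Proof.
apply: measurable_sum => j; apply: measurable_sqnorm => i.
exact: kaczmarz_cmeasurable.
Qed.

Lemma measurable_kaczmarz_bad : measurable kaczmarz_bad.
Proof.
rewrite (_ : kaczmarz_bad = [set: Om] `&` (fun w =>
  \sum_(j < N) sqnorm (kaczmarz v s (samples w) m (basis_vec j))) @^-1` `]1/4, +oo[).
  by apply: measurable_kaczmarz_sum => //.
by rewrite setTI; apply/seteqP; split => w /=; rewrite in_itv/= andbT.
Qed.

Lemma kaczmarz_bad_le : (P kaczmarz_bad <= (4 * (N%:R * (1 - t) ^+ m))%:E)%E.
Proof.
have mb := measurable_kaczmarz_bad.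
have f0 w : 0 <= \sum_(j < N) sqnorm (kaczmarz v s (samples w) m (basis_vec j)).
  by apply: sumr_ge0 => j _; exact: sqnorm_ge0.
rewrite EFinM -lee_pdivrMl//.
apply: (@le_trans _ _ (\int[P]_(w in kaczmarz_bad) (4^-1)%:E)%E).
  by rewrite integral_cst.
apply: (@le_trans _ _ (\int[P]_w (\sum_(j < N)
  (sqnorm (kaczmarz v s (samples w) m (basis_vec j)))%:E))%E).
  rewrite [leRHS](eq_integral (fun w => (\sum_(j < N)
      sqnorm (kaczmarz v s (samples w) m (basis_vec j)))%:E)); last first.
    by move=> w _; rewrite sumEFin.
  apply: (@le_trans _ _ (\int[P]_(w in kaczmarz_bad) (\sum_(j < N)
    (sqnorm (kaczmarz v s (samples w) m (basis_vec j))))%:E)%E).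
    apply: ge0_le_integral => //.
    - by apply/measurable_EFinP; apply: measurable_funTS; exact: measurable_kaczmarz_sum.
    - by move=> w; rewrite /kaczmarz_bad/= div1r lee_fin => /ltW.
  apply: ge0_subset_integral => //.
  - by apply/measurable_EFinP; exact: measurable_kaczmarz_sum.
  - by move=> w _; rewrite lee_fin.
rewrite ge0_integral_sum//.
- rewrite (_ : N%:R * _ = \sum_(j < N) ((1 - t) ^+ m * 1)); last first.
    by rewrite sumr_const card_ord mulr1 mulr_natl.
  rewrite -sumEFin; apply: lee_sum => j _.
  by have := expectation_kaczmarz_le (basis_vec j) (leqnn m); rewrite sqnorm_basis_vec.
- move=> j; apply/measurable_EFinP; apply: measurable_sqnorm => i.
  exact: kaczmarz_cmeasurable.
- by move=> j w _; rewrite lee_fin sqnorm_ge0.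
Qed.

Lemma kaczmarz_goodP w c : ~ kaczmarz_bad w ->
  sqnorm c <= 4 * \sum_(k < m) s (X k w) * Normc.normc (lincomb v c (X k w)) ^+ 2.
Proof.
move=> /negP; rewrite -leNgt => h.
under eq_bigr do rewrite -samplesE.
apply: kaczmarz_frame => //.
apply: le_trans (sqnorm_kaczmarz_le _ _ _ _ _) _.
by rewrite mulrC -[leRHS]mulrC; apply: ler_wpM2r; [exact: sqnorm_ge0|rewrite -div1r].
Qed.

End random_kaczmarz.

(** Convergence half of Borel-Cantelli. The bound is a multiple of 1/(n+1) - 1/(n+2), so the partial
    sums telescope and stay below a constant. *)
Lemma ae_eventually_notin {R : realType} {d : measure_display}
    {Om : measurableType d} (P : probability Om R) (E : (set Om)^nat) (C : R)
    (n0 : nat) :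
  (forall n, measurable (E n)) ->
  (forall n, (n0 <= n)%N -> (P (E n) <= (C / (n.+1%:R * n.+2%:R))%:E)%E) ->
  {ae P, forall w, exists n1, forall n, (n1 <= n)%N -> ~ E n w}.
Proof.
move=> mE PE.
(* Events below [n0], for which no bound is given, are discarded; this does not change the limit
   superior of the sets. *)
pose F n := if (n0 <= n)%N then E n else set0.
have mF n : measurable (F n) by rewrite /F; case: ifP.
pose C' := `|C|.
have PF n : (P (F n) <= (C' / (n.+1%:R * n.+2%:R))%:E)%E.
  rewrite /F; case: ifPn => h.
    apply: le_trans (PE _ h) _; rewrite lee_fin; apply: ler_wpM2r.
      by rewrite invr_ge0 mulr_ge0.
    exact: ler_norm.
  rewrite measure0 lee_fin; apply: divr_ge0; first exact: normr_ge0.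
  by rewrite mulr_ge0.
have S0 : (P (lim_sup_set F) = 0)%E.
  apply: lim_sup_set_cvg0 => //.
  apply: (@le_lt_trans _ _ C'%:E); last exact: ltry.
  apply: lime_le.
    by apply: is_cvg_nneseries => n _ _; exact: measure_ge0.
  apply: nearW => n.
  apply: (@le_trans _ _ (C' * (1 - n.+1%:R^-1))%:E).
    elim: n => [|n IH]; first by rewrite big_geq// invr1 subrr mulr0.
    rewrite big_nat_recr//=; apply: le_trans (leeD IH (PF n)) _.
    rewrite -EFinD lee_fin -mulrDr; apply: ler_wpM2l; first exact: normr_ge0.
    rewrite le_eqVlt; apply/orP; left; apply/eqP.
    have a0 : (n.+1%:R : R) != 0 by rewrite pnatr_eq0.
    have b0 : (n.+2%:R : R) != 0 by rewrite pnatr_eq0.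
    have e : (n.+2%:R : R) = n.+1%:R + 1 by rewrite -natr1.
    move: b0; rewrite e; move: (n.+1%:R : R) a0 => a a0 b0.
    by field; rewrite a0 b0.
  rewrite lee_fin -[leRHS]mulr1; apply: ler_wpM2l; first exact: normr_ge0.
  by rewrite lerBlDr lerDl invr_ge0.
exists (lim_sup_set F); split => //.
  by apply: bigcap_measurable => // n _; exact: bigcup_measurable.
move=> w nw n _; apply: contrapT => h; apply: nw.
exists (maxn n n0) => k; rewrite geq_max => /andP[nk n0k] Ek; apply: h.
by exists k => //; rewrite /F n0k.
Qed.

(** * Orthonormal bases and kernels *)

Section density.
Context {R : realType} {d : measure_display} {T : measurableType d}.
Variables (mu nu : {measure set T -> \bar R}) (h : T -> R).
Hypothesis mh : measurable_fun setT h.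
Hypothesis h_ge0 : forall x, 0 <= h x.
Hypothesis nuE : forall A, measurable A -> nu A = (\int[mu]_(x in A) (h x)%:E)%E.

Import HBNNSimple.

(** [nuE] describes [nu] on sets only; the formula passes to simple functions by linearity and to
    [f] by monotone convergence. *)
Lemma integral_density (f : T -> \bar R) :
  measurable_fun setT f -> (forall x, 0 <= f x)%E ->
  (\int[nu]_x f x = \int[mu]_x (f x * (h x)%:E))%E.
Proof.
move=> mf f0.
pose g := nnsfun_approx measurableT mf.
have fE x : f x = lim ((EFin \o g n) x @[n --> \oo]).
  by apply/esym/cvg_lim => //; exact: cvg_nnsfun_approx.
have gnd x : nondecreasing_seq (fun n => ((EFin \o g n) x)).
  by move=> a b ab; rewrite lee_fin; exact/lefP/nd_nnsfun_approx.
transitivity (lim (\int[nu]_x (EFin \o g n) x @[n --> \oo]))%E.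
  rewrite -monotone_convergence//.
  - by apply: eq_integral => x _; exact: fE.
  - by move=> n; exact/measurable_EFinP/measurable_funP.
  - by move=> n x _; rewrite lee_fin.
transitivity (lim (\int[mu]_x ((EFin \o g n) x * (h x)%:E) @[n --> \oo]))%E; last first.
  rewrite -monotone_convergence//.
  - apply: eq_integral => x _; apply/cvg_lim => //.
    by apply: cvgeZr => //; exact: cvg_nnsfun_approx.
  - move=> n; apply/measurable_EFinP; exact: measurable_funM.
  - by move=> n x _; rewrite mule_ge0 ?lee_fin.
  - by move=> x _ a b ab; apply: lee_wpmul2r; rewrite ?lee_fin//; exact: gnd.
apply/congr_lim/funext => n /=.
have mpre r : measurable (g n @^-1` [set r]) by exact: measurable_sfunP.
transitivity (\int[nu]_x (\sum_(r \in range (g n)) (r * \1_(g n @^-1` [set r]) x)%:E))%E.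
  by apply: eq_integral => x _; rewrite fsumEFin//= -fimfunE.
rewrite ge0_integral_fsum//; last 2 first.
- move=> r; apply/measurable_EFinP; apply: measurable_funM => //.
- by move=> r x _; exact: nnfun_muleindic_ge0.
transitivity (\int[mu]_x (\sum_(r \in range (g n))
    ((r * \1_(g n @^-1` [set r]) x)%:E * (h x)%:E)))%E; last first.
  apply: eq_integral => x _; rewrite -ge0_mule_fsuml; last first.
    by move=> r; exact: nnfun_muleindic_ge0.
  by rewrite fsumEFin//= -fimfunE.
rewrite ge0_integral_fsum//; last 2 first.
- move=> r; apply/measurable_EFinP; apply: measurable_funM => //.
  exact: measurable_funM.
- by move=> r x _; apply: mule_ge0; [exact: nnfun_muleindic_ge0|rewrite lee_fin].
apply: eq_fsbigr => r rng.
have r0 : 0 <= r by move: rng; rewrite inE => -[x _ <-].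
under eq_integral do rewrite EFinM.
rewrite ge0_integralZl_EFin//; last exact/measurable_EFinP.
rewrite integral_indic// setIT nuE//.
under [RHS]eq_integral do rewrite EFinM -muleA.
rewrite ge0_integralZl_EFin//; last 2 first.
- by move=> x _; rewrite mule_ge0 ?lee_fin.
- by apply/measurable_EFinP; exact: measurable_funM.
congr (_ * _)%E; rewrite integral_mkcond; apply: eq_integral => x _.
by rewrite patchE indicE; case: ifP; rewrite ?mul1e ?mul0e.
Qed.

End density.

Section basis.
Context {R : realType} {d : nat} {mu : probability (borel_rV R d) R}.
Context {D : set 'rV[R]_d} {V : set ('rV[R]_d -> R[i])} {N : nat}.
Variable v : 'I_N -> 'rV[R]_d -> R[i].
Hypothesis v_basis : orthonormal_basis mu D V v.
Hypothesis K_fin : (kernel_sup D v < +oo)%E.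

Local Notation K := (fine (kernel_sup D v)).

Lemma basis_cmeasurable i : @cmeasurable R _ (borel_rV R d) (v i).
Proof. by case: v_basis => /(_ i)[_ mr mi _] _ _. Qed.

Lemma basis_outside i x : ~ D x -> v i x = 0.
Proof. by case: v_basis => /(_ i)[+ _ _ _] _ _; apply. Qed.

Lemma kernel_diag_ge0 x : 0 <= kernel_diag v x.
Proof. exact: sqnorm_ge0. Qed.

Lemma kernel_diag_le x : kernel_diag v x <= K.
Proof.
have [Dx|nDx] := pselect (D x).
  have le : ((kernel_diag v x)%:E <= kernel_sup D v)%E by apply: ereal_sup_ubound; exists x.
  rewrite -lee_fin fineK// fin_real// K_fin andbT.
  by apply: lt_le_trans le; exact: ltNyr.
rewrite /kernel_diag big1 => [|i _]; last first.
  by rewrite basis_outside// Normc.normc0 expr0n.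
have [->|/set0P[y Dy]] := eqVneq D set0.
  (* For empty [D] the supremum is -oo, and [fine] turns it into 0. *)
  by rewrite /kernel_sup image_set0 ereal_sup0.
apply: fine_ge0; apply: (@le_trans _ _ (kernel_diag v y)%:E); first
  by rewrite lee_fin kernel_diag_ge0.
by apply: ereal_sup_ubound; exists y.
Qed.

Let re2 i j (x : 'rV[R]_d) := complex.Re (v i x * conjc (v j x)).
Let im2 i j (x : 'rV[R]_d) := complex.Im (v i x * conjc (v j x)).

Lemma normc_sqr_basis_le i x : Normc.normc (v i x) ^+ 2 <= K.
Proof.
apply: le_trans (kernel_diag_le x); rewrite /kernel_diag (bigD1 i)//= lerDl.
by apply: sumr_ge0 => j _; exact: sqr_ge0.
Qed.

Lemma basis_product_cmeasurable i j :
  @cmeasurable R _ (borel_rV R d) (fun x => v i x * conjc (v j x)).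
Proof.
apply: cmeasurableM; first exact: basis_cmeasurable.
by apply: cmeasurable_conj; exact: basis_cmeasurable.
Qed.

Lemma integrable_bounded (f : borel_rV R d -> R) (M : R) :
  measurable_fun setT f -> (forall x, `|f x| <= M) -> mu.-integrable setT (EFin \o f).
Proof.
move=> mf fM; apply: measurable_bounded_integrable => //.
  by rewrite (le_lt_trans (probability_le1 _ _))// ltry.
by exists M; split; [exact: num_real|move=> y My x _; exact: le_trans (fM x) (ltW My)].
Qed.

Lemma integrable_re2 i j : mu.-integrable setT (EFin \o re2 i j).
Proof.
apply: (@integrable_bounded _ (K + K)); first by have [] := basis_product_cmeasurable i j.
move=> x; apply: le_trans (lerD (normc_sqr_basis_le i x) (normc_sqr_basis_le j x)).
rewrite /re2 !sqr_normcE; case: (v i x) (v j x) => [a a'] [b b'] /=.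
rewrite ler_norml; have := sqr_ge0 (a + b); have := sqr_ge0 (a - b).
have := sqr_ge0 (a' + b'); have := sqr_ge0 (a' - b').
by move=> *; apply/andP; split; nra.
Qed.

Lemma integrable_im2 i j : mu.-integrable setT (EFin \o im2 i j).
Proof.
apply: (@integrable_bounded _ (K + K)); first by have [] := basis_product_cmeasurable i j.
move=> x; apply: le_trans (lerD (normc_sqr_basis_le i x) (normc_sqr_basis_le j x)).
rewrite /im2 !sqr_normcE; case: (v i x) (v j x) => [a a'] [b b'] /=.
rewrite ler_norml; have := sqr_ge0 (a + b'); have := sqr_ge0 (a - b').
have := sqr_ge0 (a' + b); have := sqr_ge0 (a' - b).
by move=> *; apply/andP; split; nra.
Qed.

(** [L2_inner] is built from [Rintegral], hence from [fine]; integrability is what allows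
    orthonormality to be read as an identity of extended integrals. *)
Lemma integral_re2 i j : (\int[mu]_x (re2 i j x)%:E = ((i == j)%:R)%:E)%E.
Proof.
rewrite -(fineK (integrable_fin_num measurableT (integrable_re2 i j))).
have [_ /(_ i j) + _] := v_basis.
by rewrite /L2_inner /Rintegral => /(congr1 (@complex.Re R)) /= ->; case: (i == j).
Qed.

Lemma integral_im2 i j : (\int[mu]_x (im2 i j x)%:E = 0)%E.
Proof.
rewrite -(fineK (integrable_fin_num measurableT (integrable_im2 i j))).
have [_ /(_ i j) + _] := v_basis.
by rewrite /L2_inner /Rintegral => /(congr1 (@complex.Im R)) /= ->; case: (i == j).
Qed.

(** Parseval: expanding the square over pairs of indices leaves only the diagonal, by [integral_re2]
    and [integral_im2]. *)
Lemma integral_lincomb c :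
  (\int[mu]_x (Normc.normc (lincomb v c x) ^+ 2)%:E = (sqnorm c)%:E)%E.
Proof.
pose a i j := c i * conjc (c j).
pose t (p : 'I_N * 'I_N) x :=
  complex.Re (a p.1 p.2) * re2 p.1 p.2 x - complex.Im (a p.1 p.2) * im2 p.1 p.2 x.
have fE x : Normc.normc (lincomb v c x) ^+ 2 = \sum_p t p x.
  rewrite -Re_conj_mul mulrC /lincomb mulr_suml Re_sum.
  rewrite -(pair_bigA _ (fun i j => t (i, j) x))/=; apply: eq_bigr => i _.
  rewrite rmorph_sum mulr_sumr Re_sum; apply: eq_bigr => j _.
  rewrite /t /re2 /im2 /a /=.
  by case: (c i) (c j) (v i x) (v j x) => [? ?] [? ?] [? ?] [? ?] /=; ring.
have intre r i j : mu.-integrable setT (EFin \o (fun x => r * re2 i j x)).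
  rewrite (_ : _ \o _ = fun x => (r%:E * (re2 i j x)%:E)%E)//.
  by apply: integrableZl => //; exact: integrable_re2.
have intim r i j : mu.-integrable setT (EFin \o (fun x => r * im2 i j x)).
  rewrite (_ : _ \o _ = fun x => (r%:E * (im2 i j x)%:E)%E)//.
  by apply: integrableZl => //; exact: integrable_im2.
rewrite (eq_integral (fun x : borel_rV R d => (\sum_p (t p x)%:E)%E)); last first.
  by move=> x _; rewrite fE sumEFin.
rewrite integral_sum//; last first.
  by move=> p; exact: (integrableB measurableT (intre _ p.1 p.2) (intim _ p.1 p.2)).
rewrite (eq_bigr (fun p => (complex.Re (a p.1 p.2) * (p.1 == p.2)%:R)%:E)); last first.
  move=> p _; rewrite (eq_integral (fun x : borel_rV R d =>
    (complex.Re (a p.1 p.2) * re2 p.1 p.2 x)%:E -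
    (complex.Im (a p.1 p.2) * im2 p.1 p.2 x)%:E)%E)//.
  rewrite (integralB_EFin _ (intre _ _ _) (intim _ _ _))//=.
  under eq_integral do rewrite EFinM.
  rewrite integralZl//; last exact: integrable_re2.
  under [X in (_ - X)%E]eq_integral do rewrite EFinM.
  rewrite integralZl//; last exact: integrable_im2.
  by rewrite integral_re2 integral_im2 mule0 sube0.
rewrite sumEFin; congr (_%:E).
rewrite -(pair_bigA _ (fun i j => complex.Re (a i j) * (i == j)%:R))/=.
apply: eq_bigr => i _; rewrite (bigD1 i)//= eqxx mulr1 big1 ?addr0; last first.
  by move=> j ij; rewrite eq_sym (negbTE ij) mulr0.
by rewrite /a -Re_conj_mul mulrC.
Qed.

Lemma basis_lincomb f : V f -> exists c, f = lincomb v c.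
Proof. by case: v_basis => _ _ -> [c ->]; exists c. Qed.

Lemma lincomb_mem c : V (lincomb v c).
Proof. by case: v_basis => _ _ ->; exists c. Qed.

Lemma normc_lincomb_le c x : Normc.normc (lincomb v c x) ^+ 2 <= K * sqnorm c.
Proof.
apply: le_trans (normc_sum_mul_sqr_le c (v^~ x)) _.
by rewrite mulrC; apply: ler_wpM2r; [exact: sqnorm_ge0|exact: kernel_diag_le].
Qed.

Lemma integral_kernel_diag : (\int[mu]_x (kernel_diag v x)%:E = (N%:R)%:E)%E.
Proof.
rewrite (eq_integral (fun x : borel_rV R d =>
    (\sum_(i < N) (Normc.normc (v i x) ^+ 2)%:E)%E)); last first.
  by move=> x _; rewrite sumEFin.
rewrite ge0_integral_sum//; last 2 first.
- by move=> i; apply/measurable_EFinP; apply: measurable_sqr_normc; exact: basis_cmeasurable.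
- by move=> i x _; rewrite lee_fin sqr_ge0.
rewrite (eq_bigr (fun=> 1%E)); last first.
  move=> i _; rewrite -[1%E]/(1%:E) -(sqnorm_basis_vec (R := R) i) -integral_lincomb.
  apply: eq_integral => x _; congr (_ ^+ 2)%:E; congr (Normc.normc _).
  rewrite /lincomb (bigD1 i)//= /basis_vec eqxx mul1r big1 ?addr0// => j ij.
  by rewrite (negbTE ij) mul0r.
by rewrite (eq_bigr (fun=> (1 : R)%:E))// sumEFin sumr_const card_ord.
Qed.

(** The average of [kernel_diag] under the probability [mu] is [N], and a supremum is at least an
    average. *)
Lemma dim_le_kernel_sup : N%:R <= K.
Proof.
rewrite -lee_fin -integral_kernel_diag.
apply: (@le_trans _ _ (\int[mu]_x K%:E)%E).
  apply: ge0_le_integral => //.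
  - by move=> x _; rewrite lee_fin kernel_diag_ge0.
  - apply/measurable_EFinP.
    apply: (@measurable_sqnorm _ N _ (borel_rV R d) (fun x i => v i x)).
    exact: basis_cmeasurable.
  - by move=> x _; rewrite lee_fin; exact: kernel_diag_le.
by rewrite integral_cst// [X in (_ * X)%E](@probability_setT _ _ _ mu) mule1.
Qed.

(** The constant has norm at most 1 in L^2, so Cauchy-Schwarz at [x] bounds its value 1 by
    [kernel_diag v x]. This keeps the weight 1/K(x,x) of item 2 at most 1. *)
Lemma kernel_diag_ge1 : V (\1_D) -> forall x, D x -> 1 <= kernel_diag v x.
Proof.
move=> V1 x Dx; have [c cE] := basis_lincomb V1.
have nc y : Normc.normc (lincomb v c y) ^+ 2 <= 1.
  rewrite -cE indicE; case: (y \in D); first by rewrite Normc.normc1 expr1n.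
  by rewrite Normc.normc0 expr0n.
have c1 : sqnorm c <= 1.
  rewrite -lee_fin -integral_lincomb.
  apply: (@le_trans _ _ (\int[mu]_x 1%:E)%E).
    apply: ge0_le_integral => //.
    - by move=> y _; rewrite lee_fin sqr_ge0.
    - apply/measurable_EFinP; apply: measurable_sqr_normc.
      apply: (@lincomb_cmeasurable _ _ (borel_rV R d) N v basis_cmeasurable _ _ id (fun=> c)) => //.
      by move=> i; exact: cmeasurable_cst.
    - by move=> y _; rewrite lee_fin.
  by rewrite integral_cst// [X in (_ * X)%E](@probability_setT _ _ _ mu) mule1.
have : Normc.normc (lincomb v c x) ^+ 2 = 1.
  by rewrite -cE indicE mem_set// Normc.normc1 expr1n.
move=> <-; apply: le_trans (normc_sum_mul_sqr_le c (v^~ x)) _.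
by rewrite -[leRHS]mul1r; apply: ler_wpM2r => //; exact: sqnorm_ge0.
Qed.

End basis.

(** * Sample sizes and failure probabilities *)

Section growth.
Context {R : realType}.
Implicit Types (x p e c t : R).

(** For an integer [k] with [delta * k >= p + 2] and [y = c x^delta / k], exp(k y) = exp(y)^k >=
    y^k, and y^k is at least a constant times x^(p + 2). *)
Lemma powR_expR_decay p (delta c : R) : 0 < delta -> 0 < c ->
  exists2 C : R, 0 <= C & forall x, 1 <= x ->
    x `^ p * expR (- (c * x `^ delta)) <= C / x ^+ 2.
Proof.
move=> d0 c0.
pose k := (Num.truncn `|(p + 2) / delta|).+1.
have k0 : 0 < k%:R :> R by rewrite ltr0n.
have dk : p + 2 <= delta * k%:R.
  rewrite mulrC -ler_pdivrMr//; apply: le_trans (ler_norm _) _.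
  by apply: ltW; exact: truncnS_gt.
exists (((c / k%:R) ^+ k)^-1); first by rewrite invr_ge0 exprn_ge0// divr_ge0// ltW.
move=> x x1; have x0 : 0 < x by exact: lt_le_trans x1.
pose y := c / k%:R * x `^ delta.
have y0 : 0 <= y by rewrite mulr_ge0 ?divr_ge0 ?powR_ge0 ?ltW.
have le1 : (c / k%:R) ^+ k * (x `^ p * x ^+ 2) <= expR (c * x `^ delta).
  rewrite (_ : c * x `^ delta = k%:R * y); last first.
    by rewrite /y mulrA [k%:R * _]mulrC divfK// gt_eqF.
  rewrite expRM_natl; apply: (@le_trans _ _ (y ^+ k)); last first.
    rewrite lerXn2r ?nnegrE ?expR_ge0//.
    by apply: le_trans (expR_ge1Dx y); rewrite lerDr.
  rewrite /y [in leRHS]exprMn; apply: ler_wpM2l; first by rewrite exprn_ge0// divr_ge0// ltW.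
  rewrite -(powR_mulrn k (powR_ge0 x delta)) -powRrM -(powR_mulrn 2 (ltW x0)) -powRD; last first.
    by rewrite (gt_eqF x0) implybT.
  by apply: ler_powR.
have x2 : 0 < x ^+ 2 by rewrite exprn_gt0.
have ck : 0 < (c / k%:R) ^+ k by rewrite exprn_gt0// divr_gt0.
rewrite expRN ler_pdivrMr ?expR_gt0//.
rewrite -invfM mulrC ler_pdivlMr; last exact: mulr_gt0.
by rewrite mulrCA.
Qed.

(** From [1 - t <= expR (- t)]: truncation lowers the bound c x^delta for [t * m] by at most c / x^e
    <= c, whence the extra factor [expR c]. The condition [1 <= x^e] is the form in which the
    exponents used later are controlled; their sign is not at hand. *)
Lemma pow_truncn_decay p (delta c : R) : 0 < delta -> 0 < c ->
  exists2 C : R, 0 <= C & forall x e t, 1 <= x -> 1 <= x `^ e ->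
    0 <= t <= 1 -> c / x `^ e <= t ->
    x `^ p * (1 - t) ^+ Num.truncn (x `^ (e + delta)) <= C / x ^+ 2.
Proof.
move=> d0 c0; have [C C0 CP] := powR_expR_decay p d0 c0.
exists (expR c * C); first by rewrite mulr_ge0 ?expR_ge0.
move=> x e t x1 xe1 /andP[t0 t1] ct.
have x0 : 0 < x by exact: lt_le_trans x1.
have xe0 : 0 < x `^ e by exact: powR_gt0.
set m := Num.truncn _.
have mge : x `^ e * x `^ delta - 1 <= m%:R.
  rewrite lerBlDr natr1 -powRD; last by rewrite (gt_eqF x0) implybT.
  by apply: ltW; exact: truncnS_gt.
have tm : c * x `^ delta - c <= t * m%:R.
  have xd1 : 1 <= x `^ delta by rewrite -[leLHS](powRr0 x) ler_powR// ltW.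
  apply: (@le_trans _ _ (c / x `^ e * m%:R)); last by rewrite ler_wpM2r.
  apply: (@le_trans _ _ (c / x `^ e * (x `^ e * x `^ delta - 1))); last first.
    by apply: ler_wpM2l => //; apply: divr_ge0; exact: ltW.
  rewrite mulrBr mulr1 mulrA divfK ?gt_eqF// lerD2l lerN2.
  by rewrite ler_pdivrMr// ler_peMr// ltW.
have pw : (1 - t) ^+ m <= expR c * expR (- (c * x `^ delta)).
  apply: (@le_trans _ _ (expR (- t) ^+ m)).
    by rewrite lerXn2r ?nnegrE ?expR_ge0 ?subr_ge0//; exact: expR_ge1Dx.
  rewrite -expRM_natr -expRD ler_expR; lra.
apply: le_trans (ler_wpM2l (powR_ge0 _ _) pw) _.
by rewrite mulrCA -mulrA; apply: ler_wpM2l; [exact: expR_ge0|exact: CP].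
Qed.

Lemma inv_sqr_le_telescope (x C : R) n : 0 <= C -> n.+1%:R <= x ->
  C / x ^+ 2 <= 2 * C / (n.+1%:R * n.+2%:R).
Proof.
move=> C0 nx; have n0 : 0 < n.+1%:R :> R by rewrite ltr0n.
have x0 : 0 < x by exact: lt_le_trans nx.
rewrite [2 * C]mulrC -mulrA; apply: ler_wpM2l => //.
rewrite -[leLHS]mul1r ler_pdivrMr ?exprn_gt0// mulrAC ler_pdivlMr; last first.
  by rewrite mulr_gt0.
have e : (n.+2%:R : R) = n.+1%:R + 1 by rewrite -natr1.
have n1 : 1 <= n.+1%:R :> R by rewrite ler1n.
rewrite e; nra.
Qed.

Lemma limn_esup_lt (u : (\bar R)^nat) (l : \bar R) : (limn_esup u < l)%E ->
  exists n0, forall n, (n0 <= n)%N -> (u n < l)%E.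
Proof.
rewrite /limn_esup /limf_esup => /ereal_inf_lt[_ [A [n0 _ n0A] <-] supA].
exists n0 => n n0n; apply: le_lt_trans supA.
by apply: ereal_sup_ubound; exists n => //; exact: n0A.
Qed.

(** If the limsup is -oo, then [fine] gives 0 and the bound by [e] still holds eventually. *)
Lemma limn_esup_fine_lt (u : (\bar R)^nat) e : (limn_esup u < +oo)%E -> 0 < e ->
  exists n0, forall n, (n0 <= n)%N -> (u n < (fine (limn_esup u) + e)%:E)%E.
Proof.
move=> uoo e0; apply: limn_esup_lt; move: uoo.
by case: (limn_esup u) => [r| |]//= _; rewrite ?ltNyr// lte_fin ltrDl.
Qed.

Lemma lt_powR_of_lne (A : \bar R) x l : (0 <= A)%E -> 1 < x ->
  (lne A / (ln x)%:E < l%:E)%E -> (A < (x `^ l)%:E)%E.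
Proof.
move=> A0 x1; have lx : 0 < ln x by rewrite ln_gt0.
have x0 : 0 < x by exact: lt_trans x1.
rewrite inver gt_eqF//; case: A A0 => [r| |]//= r0; last first.
  by rewrite gt0_mulye ?lte_fin ?invr_gt0.
case: ifPn => [rle _|]; first by rewrite lte_fin (le_lt_trans rle)// powR_gt0.
rewrite -ltNge => rgt; rewrite -EFinM !lte_fin ltr_pdivrMr// => h.
by rewrite /powR gt_eqF// -{1}(lnK rgt) ltr_expR.
Qed.

End growth.

(** Reduction to a single level: for each [n] an exceptional event of summable probability. The
    constant [kb] obtained is deterministic; only the threshold depends on the realization. *)
Lemma random_admissible_meshI {R : realType} {d : nat} (D : set 'rV[R]_d)
    (V : nat -> set ('rV[R]_d -> R[i])) (N : nat -> nat)
    (rho : nat -> set (borel_rV R d) -> \bar R) (a b : R)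
    (m : nat -> nat) (ka kb C : R) (n0 : nat) :
  (forall n, (n0 <= n)%N -> (m n)%:R <= ka * (N n)%:R `^ a) ->
  (forall n, (n0 <= n)%N ->
    forall (disp : measure_display) (Om : measurableType disp)
      (P : probability Om R) (X : 'I_(m n) -> {RV P >-> borel_rV R d}),
    iid_samples (rho n) X ->
    exists E : set Om, [/\ measurable E,
      (P E <= (C / (n.+1%:R * n.+2%:R))%:E)%E &
      forall w, ~ E w -> forall f, V n f ->
        (ereal_sup [set (Normc.normc (f x))%:E | x in D] <=
         (kb * (N n)%:R `^ b *
          \big[Num.max/0]_(k < m n) Normc.normc (f (X k w)))%:E)%E]) ->
  random_admissible_mesh D V N rho a b.
Proof.
move=> mle bad; exists m, ka => disp Om P X iid.
have /choice[E EP] : forall n, exists E : set Om, measurable E /\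
    ((n0 <= n)%N -> (P E <= (C / (n.+1%:R * n.+2%:R))%:E)%E /\
      forall w, ~ E w -> forall f, V n f ->
        (ereal_sup [set (Normc.normc (f x))%:E | x in D] <=
         (kb * (N n)%:R `^ b *
          \big[Num.max/0]_(k < m n) Normc.normc (f (X n k w)))%:E)%E).
  move=> n; have [h|h] := leqP n0 n; last by exists set0; split => //.
  by have [E [mE PE EP]] := bad _ h _ _ _ _ (iid n); exists E.
have := @ae_eventually_notin _ _ _ P E C n0 (fun n => (EP n).1)
  (fun n h => ((EP n).2 h).1).
apply: filterS => w [n1 n1P]; exists kb, (maxn n0 n1) => n.
rewrite geq_max => /andP[h0 h1]; split; last exact: mle.
by move=> f Vf; apply: ((EP n).2 h0).2 => //; exact: n1P.
Qed.

(** * Random weakly admissible meshes *)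

Section sampling.
Context {R : realType} {d : nat} {mu : probability (borel_rV R d) R}.
Context {D : set 'rV[R]_d} {V : set ('rV[R]_d -> R[i])} {N : nat}.
Variable v : 'I_N -> 'rV[R]_d -> R[i].
Hypothesis v_basis : orthonormal_basis mu D V v.
Hypothesis K_fin : (kernel_sup D v < +oo)%E.
Local Notation K := (fine (kernel_sup D v)).
Variables (rho : set (borel_rV R d) -> \bar R) (s : borel_rV R d -> R) (t sigma : R).
Hypothesis ms : measurable_fun [set: borel_rV R d] s.
Hypothesis s_ge0 : forall x, 0 <= s x.
Hypothesis s_le : forall x, s x * sqnorm (v^~ x) <= 1.
Hypothesis t01 : 0 <= t <= 1.
Hypothesis s_sigma : forall c x,
  s x * Normc.normc (lincomb v c x) ^+ 2 <= sigma * Normc.normc (lincomb v c x) ^+ 2.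
Hypothesis sigma_ge0 : 0 <= sigma.
Hypothesis rho_frame : forall nu : probability (borel_rV R d) R,
  (forall A, measurable A -> nu A = rho A) -> forall c,
  ((t * sqnorm c)%:E <=
   \int[nu]_x (s x * Normc.normc (lincomb v c x) ^+ 2)%:E)%E.

Let mv := basis_cmeasurable v_basis.

Lemma measurable_sqr_normc_lincomb c :
  measurable_fun [set: borel_rV R d] (fun x => Normc.normc (lincomb v c x) ^+ 2).
Proof.
apply: measurable_sqr_normc.
apply: (@lincomb_cmeasurable _ _ (borel_rV R d) N v mv _ _ id (fun=> c)) => //.
by move=> i; exact: cmeasurable_cst.
Qed.

(** [rho] is only a set function, so the claim is made for every probability with the same values on
    measurable sets, such as the law of a sample. The energy inequality of one step is integrated
    and the frame bound subtracted. *)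
Lemma step_contract_of_frame (nu : probability (borel_rV R d) R) c :
  (forall A, measurable A -> nu A = rho A) ->
  (\int[nu]_x (sqnorm (kaczmarz_step v s x c))%:E <= ((1 - t) * sqnorm c)%:E)%E.
Proof.
move=> nuE.
have mk : measurable_fun [set: borel_rV R d] (fun x => sqnorm (kaczmarz_step v s x c)).
  apply: (@measurable_sqnorm _ N _ (borel_rV R d) (fun x => kaczmarz_step v s x c)).
  move=> i; apply: (@kaczmarz_step_cmeasurable _ _ (borel_rV R d) _ _ _ mv ms _
    (borel_rV R d) id (fun=> c)) => //.
  by move=> j; exact: cmeasurable_cst.
have msf : measurable_fun [set: borel_rV R d]
    (fun x => s x * Normc.normc (lincomb v c x) ^+ 2).
  by apply: measurable_funM => //; exact: measurable_sqr_normc_lincomb.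
have : (\int[nu]_x (sqnorm (kaczmarz_step v s x c))%:E +
    \int[nu]_x (s x * Normc.normc (lincomb v c x) ^+ 2)%:E <= (sqnorm c)%:E)%E.
  rewrite -ge0_integralD//; first last.
  - exact/measurable_EFinP.
  - by move=> x _; rewrite lee_fin mulr_ge0 ?sqr_ge0.
  - exact/measurable_EFinP.
  - by move=> x _; rewrite lee_fin sqnorm_ge0.
  apply: (@le_trans _ _ (\int[nu]_x (sqnorm c)%:E)%E); last first.
    by rewrite integral_cst// [X in (_ * X)%E](@probability_setT _ _ _ nu) mule1.
  apply: ge0_le_integral => //.
  - by move=> x _; rewrite adde_ge0// lee_fin ?sqnorm_ge0// mulr_ge0 ?sqr_ge0.
  - by apply: emeasurable_funD; exact/measurable_EFinP.
  - by move=> x _; rewrite -EFinD lee_fin; exact: sqnorm_kaczmarz_step_le.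
move=> h; rewrite mulrBl mul1r EFinB leeBrDr//.
by apply: le_trans (leeD2l _ (rho_frame nuE c)) h.
Qed.

Lemma sampling_bound m (disp : measure_display) (Om : measurableType disp)
    (P : probability Om R) (X : 'I_m -> {RV P >-> borel_rV R d}) :
  iid_samples rho X ->
  exists E : set Om, [/\ measurable E,
    (P E <= (4 * (N%:R * (1 - t) ^+ m))%:E)%E &
    forall w, ~ E w -> forall f, V f ->
      (ereal_sup [set (Normc.normc (f x))%:E | x in D] <=
       (2 * Num.sqrt (K * sigma * m%:R) *
        \big[Num.max/0]_(k < m) Normc.normc (f (X k w)))%:E)%E].
Proof.
move=> [Xrho Xind].
have K0 : 0 <= K by apply: le_trans (dim_le_kernel_sup v_basis K_fin).
exists (kaczmarz_bad (v : 'I_N -> borel_rV R d -> R[i]) s X); split.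
- exact: measurable_kaczmarz_bad.
- apply: kaczmarz_bad_le => // k c.
  by apply: step_contract_of_frame => A mA; exact: Xrho.
move=> w wE f Vf; have [c fE] := basis_lincomb v_basis Vf.
set M := \big[_/_]_(k < m) _.
have M0 : 0 <= M by exact: bigmax_ge_id.
have cM : sqnorm c <= 4 * (m%:R * (sigma * M ^+ 2)).
  apply: le_trans (kaczmarz_goodP s_ge0 s_le c wE) _.
  apply: ler_wpM2l => //.
  rewrite (_ : m%:R * _ = \sum_(k < m) sigma * M ^+ 2); last first.
    by rewrite sumr_const card_ord mulr_natl.
  apply: ler_sum => k _; apply: le_trans (s_sigma _ _) _.
  apply: ler_wpM2l => //; rewrite -fE lerXn2r ?nnegrE ?normc_ge0//.
  exact: (@le_bigmax _ _ _ _ (fun k => Normc.normc (f (X k w)))).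
apply: ge_ereal_sup => _ [x Dx <-]; rewrite lee_fin.
have rhs0 : 0 <= 2 * Num.sqrt (K * sigma * m%:R) * M.
  by rewrite mulr_ge0// mulr_ge0// sqrtr_ge0.
rewrite -(ler_pXn2r (n := 2)) ?nnegrE ?normc_ge0// fE.
apply: le_trans (normc_lincomb_le v_basis K_fin c x) _.
rewrite !exprMn sqr_sqrtr; last by rewrite !mulr_ge0.
apply: le_trans (ler_wpM2l K0 cM) _.
by rewrite le_eqVlt; apply/orP; left; apply/eqP; ring.
Qed.

End sampling.

Section wam.
Context {R : realType} {d : nat}.
Variables (mu : probability (borel_rV R d) R) (D : set 'rV[R]_d).
Variables (V : nat -> set ('rV[R]_d -> R[i])) (N : nat -> nat).
Unset Implicit Arguments.
Variable v : forall n, 'I_(N n) -> 'rV[R]_d -> R[i].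
Set Implicit Arguments.
Hypothesis v_basis : forall n, orthonormal_basis mu D (V n) (v n).
Hypothesis N_gt0 : forall n, (0 < N n)%N.
Hypothesis N_lt : forall n, (N n < N n.+1)%N.
Hypothesis K_fin : forall n, (kernel_sup D (v n) < +oo)%E.
Hypothesis q_fin : (q_star D v < +oo)%E.

Lemma dim_ge n : (n < N n)%N.
Proof. by elim: n => // n IH; apply: leq_trans (N_lt n). Qed.

Lemma dim_ge1 n : 1 <= (N n)%:R :> R.
Proof. by rewrite ler1n. Qed.

Lemma kernel_sup_eventually (e : R) : 0 < e -> exists n0, forall n, (n0 <= n)%N ->
  fine (kernel_sup D (v n)) <= (N n)%:R `^ (fine (q_star D v) + e).
Proof.
move=> e0; have [n0 n0P] := limn_esup_fine_lt q_fin e0.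
(* The bound [1 <= n] gives [N n >= 2], so that the logarithm in the denominator is positive. *)
exists (maxn n0 1) => n; rewrite geq_max => /andP[h0 h1].
have K1 : (N n)%:R <= fine (kernel_sup D (v n)) := dim_le_kernel_sup (v_basis n) (K_fin n).
have Kfin : kernel_sup D (v n) \is a fin_num.
  apply: fin_real; rewrite K_fin andbT ltNye; apply/eqP => Koo.
  by move: K1; rewrite Koo/= leNgt ltr0n N_gt0.
rewrite -lee_fin fineK//; apply: ltW; apply: lt_powR_of_lne.
- by rewrite -(fineK Kfin) lee_fin (le_trans _ K1).
- by rewrite ltr1n; apply: leq_ltn_trans h1 (dim_ge n).
- exact: n0P.
Qed.

(** Common part of items 1 and 2: [t] is N^-a and [m] about N^(a + delta), so that [m * t] grows
    like N^delta. The last hypothesis amounts to K sigma m <= N^(2 b). *)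
Lemma wam_of_frame (rho : nat -> set (borel_rV R d) -> \bar R)
    (s : nat -> borel_rV R d -> R) (t sigma : nat -> R) (n0 : nat) (a delta b : R) :
  0 < delta ->
  (forall n, measurable_fun [set: borel_rV R d] (s n)) ->
  (forall n x, 0 <= s n x) ->
  (forall n, (n0 <= n)%N -> forall x, s n x * sqnorm ((v n)^~ x) <= 1) ->
  (forall n, 0 <= sigma n) ->
  (forall n c x, s n x * Normc.normc (lincomb (v n) c x) ^+ 2 <=
    sigma n * Normc.normc (lincomb (v n) c x) ^+ 2) ->
  (forall n (nu : probability (borel_rV R d) R),
    (forall A, measurable A -> nu A = rho n A) -> forall c,
    ((t n * sqnorm c)%:E <=
     \int[nu]_x (s n x * Normc.normc (lincomb (v n) c x) ^+ 2)%:E)%E) ->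
  (forall n, (n0 <= n)%N -> t n = ((N n)%:R `^ a)^-1) ->
  (forall n, (n0 <= n)%N -> 1 <= (N n)%:R `^ a) ->
  (forall n, (n0 <= n)%N ->
    fine (kernel_sup D (v n)) * sigma n * (N n)%:R `^ (a + delta) <=
    ((N n)%:R `^ b) ^+ 2) ->
  random_admissible_mesh D V N rho (a + delta) b.
Proof.
move=> d0 ms s0 s1 sig0 s_sig frame tE Na1 Kb.
pose m n := Num.truncn ((N n)%:R `^ (a + delta) : R).
have mle n : (m n)%:R <= (N n)%:R `^ (a + delta) :> R by rewrite truncn_le powR_ge0.
(* Power 1 of N because the failure probability is 4 N (1 - t)^m; constant 1 because [t] is exactly
   N^-a. *)
have [C C0 CP] := pow_truncn_decay 1 d0 (ltr01 : 0 < 1 :> R).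
apply: (@random_admissible_meshI _ _ _ _ _ _ _ _ m 1 2 (2 * (4 * C)) n0).
  by move=> n _; rewrite mul1r.
move=> n h disp Om P X iid.
have a0 : 0 < (N n)%:R `^ a by apply: lt_le_trans (Na1 _ h).
have t01 : 0 <= t n <= 1 by rewrite tE// invr_ge0 (ltW a0)/= invf_le1// Na1.
have [E [mE PE EP]] := sampling_bound (v_basis n) (K_fin n) (ms n) (s0 n) (s1 _ h) t01
  (s_sig n) (sig0 n) (frame n) iid.
exists E; split => //.
  apply: le_trans PE _; rewrite lee_fin.
  apply: le_trans (inv_sqr_le_telescope (x := (N n)%:R) _ _); last 2 first.
  - by rewrite mulr_ge0.
  - by rewrite ler_nat; exact: dim_ge.
  rewrite -mulrA ler_wpM2l// -[X in X * _](powRr1 (ler0n _ (N n))).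
  by apply: CP => //; [exact: dim_ge1|exact: Na1|rewrite tE// div1r].
move=> w wE f Vf; apply: le_trans (EP w wE f Vf) _; rewrite lee_fin.
apply: ler_wpM2r; first exact: bigmax_ge_id.
apply: ler_wpM2l => //; rewrite -(ger0_norm (powR_ge0 _ b)) -sqrtr_sqr.
rewrite ler_wsqrtr//; apply: le_trans (Kb _ h).
apply: ler_wpM2l => //; rewrite mulr_ge0//.
by apply: le_trans (dim_le_kernel_sup (v_basis n) (K_fin n)).
Qed.

Variable eps : R.
Hypothesis eps_gt0 : 0 < eps.
Local Notation q := (fine (q_star D v)).

Lemma powR_sqr (x b : R) : (x `^ b) ^+ 2 = x `^ (b * 2).
Proof. by rewrite -powR_mulrn ?powR_ge0// -powRrM. Qed.

Lemma wam_measure : random_admissible_mesh D V N (fun=> mu) (q + eps) (q / 2 + eps).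
Proof.
have e2 : 0 < eps / 2 by rewrite divr_gt0.
have [n0 n0P] := kernel_sup_eventually e2.
(* One half of [eps] pays for passing from the limsup to an inequality, the other for
   oversampling. *)
have -> : q + eps = q + eps / 2 + eps / 2 by rewrite -addrA -splitr.
pose t n := ((N n)%:R `^ (q + eps / 2))^-1 : R.
have t0 n : 0 <= t n by rewrite invr_ge0 powR_ge0.
have Na0 n : 0 < (N n)%:R `^ (q + eps / 2) :> R by rewrite powR_gt0// ltr0n.
apply: (@wam_of_frame _ (fun n _ => t n) t t n0 _ (eps / 2)) => //.
- move=> n h x; rewrite mulrC ler_pdivrMr// mul1r.
  by apply: le_trans (kernel_diag_le (v_basis n) (K_fin n) x) (n0P _ h).
- move=> n nu nuE c.
  have -> : (\int[nu]_x (t n * Normc.normc (lincomb (v n) c x) ^+ 2)%:E =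
      \int[mu]_x (t n * Normc.normc (lincomb (v n) c x) ^+ 2)%:E)%E.
    by apply: eq_measure_integral => A mA _; exact: nuE.
  under eq_integral do rewrite EFinM.
  rewrite ge0_integralZl_EFin//; first last.
  - by apply/measurable_EFinP; exact: (measurable_sqr_normc_lincomb (v_basis n)).
  - by move=> x _; rewrite lee_fin sqr_ge0.
  by rewrite (integral_lincomb (v_basis n) (K_fin n)) EFinM.
- move=> n h; apply: le_trans (n0P _ h).
  by apply: le_trans (dim_le_kernel_sup (v_basis n) (K_fin n)); exact: dim_ge1.
- move=> n h; apply: (@le_trans _ _ ((N n)%:R `^ (q + eps / 2 + eps / 2))).
    rewrite -[leRHS]mul1r; apply: ler_wpM2r; first exact: powR_ge0.
    by rewrite ler_pdivrMr// mul1r n0P.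
  by rewrite powR_sqr; apply: ler_powR; [exact: dim_ge1|lra].
Qed.

Hypothesis V_sub : forall n, V n `<=` V n.+1.

Lemma wam_induced_measure : V 0%N (\1_D) ->
  random_admissible_mesh D V N (fun n => induced_measure mu (v n))
    (1 + eps) ((q + 1) / 2 + eps).
Proof.
move=> V01.
have Vn1 n : V n (\1_D) by elim: n => // n; exact: V_sub.
have [n0 n0P] := kernel_sup_eventually eps_gt0.
have mk n : measurable_fun [set: borel_rV R d] (kernel_diag (v n)).
  apply: (@measurable_sqnorm _ (N n) _ (borel_rV R d) (fun x i => v n i x)).
  exact: (basis_cmeasurable (v_basis n)).
have N0 n : 0 < (N n)%:R :> R by rewrite ltr0n.
have k0 n x : 0 <= kernel_diag (v n) x by exact: kernel_diag_ge0.
have mki n : measurable_fun [set: borel_rV R d] (fun x => (kernel_diag (v n) x)^-1).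
  under eq_fun do rewrite -(powR_inv1 (k0 n _)).
  exact: (measurableT_comp (measurable_powR (-1)) (mk n)).
(* Where K(x,x) vanishes, every function of the space vanishes; this makes the default inverse 0 a
   correct weight there. *)
have lin0 n c x : kernel_diag (v n) x = 0 -> Normc.normc (lincomb (v n) c x) ^+ 2 = 0.
  move=> kx; apply/eqP; rewrite eq_le sqr_ge0 andbT.
  apply: le_trans (normc_sum_mul_sqr_le c ((v n)^~ x)) _.
  by rewrite [sqnorm ((v n)^~ x)]kx mulr0.
apply: (@wam_of_frame _ (fun n x => (kernel_diag (v n) x)^-1)
  (fun n => (N n)%:R^-1) (fun=> 1) n0) => //.
- by move=> n x; rewrite invr_ge0.
- move=> n _ x; rewrite -[sqnorm ((v n)^~ x)]/(kernel_diag (v n) x).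
  by have [->|k1] := eqVneq (kernel_diag (v n) x) 0; rewrite ?mulr0// mulVf.
- move=> n c x; have [Dx|nDx] := pselect (D x).
    apply: ler_wpM2r; first exact: sqr_ge0.
    have := kernel_diag_ge1 (v_basis n) (K_fin n) (Vn1 n) Dx => k1.
    by rewrite invf_le1// (lt_le_trans _ k1).
  rewrite lin0 ?mulr0// /kernel_diag big1// => i _.
  by rewrite (basis_outside (v_basis n) i nDx) Normc.normc0 expr0n.
- move=> n nu nuE c.
  rewrite (@integral_density _ _ _ mu nu (fun x => (N n)%:R^-1 * kernel_diag (v n) x)); first last.
  + by move=> x; rewrite lee_fin mulr_ge0 ?invr_ge0 ?sqr_ge0.
  + apply/measurable_EFinP; apply: measurable_funM.
      exact: mki.
    exact: (measurable_sqr_normc_lincomb (v_basis n)).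
  + exact: nuE.
  + by move=> x; rewrite mulr_ge0 ?invr_ge0.
  + by apply: measurable_funM.
  (* The weight 1/K cancels the density K/N, so by Parseval the frame bound holds with equality for
     t = 1/N. *)
  rewrite (eq_integral (fun x : borel_rV R d =>
    ((N n)%:R^-1)%:E * (Normc.normc (lincomb (v n) c x) ^+ 2)%:E)%E); last first.
    move=> x _; rewrite -!EFinM; congr (_%:E).
    have [kx|kx] := eqVneq (kernel_diag (v n) x) 0; last by field; rewrite kx gt_eqF.
    by rewrite lin0// !(mulr0, mul0r).
  rewrite ge0_integralZl_EFin//; first last.
  + by apply/measurable_EFinP; exact: (measurable_sqr_normc_lincomb (v_basis n)).
  + by move=> x _; rewrite lee_fin sqr_ge0.
  by rewrite (integral_lincomb (v_basis n) (K_fin n)) EFinM.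
- by move=> n _; rewrite powRr1.
- by move=> n _; rewrite powRr1//; exact: dim_ge1.
(* K and m each use one [eps]: (q + eps) + (1 + eps) = 2 b. *)
- move=> n h; rewrite mulr1 powR_sqr.
  apply: (@le_trans _ _ ((N n)%:R `^ (q + eps) * (N n)%:R `^ (1 + eps))).
    by apply: ler_wpM2r; [exact: powR_ge0|exact: n0P].
  rewrite -powRD; last by rewrite (gt_eqF (N0 n)) implybT.
  by apply: ler_powR; [exact: dim_ge1|lra].
Qed.

End wam.

(** * Lebesgue measure of cubes *)

Section volume.
Context {R : realType}.

Definition tuple_cube n (y : 'I_n -> R) (r : R) : set (n.-tuple (measurableTypeR R)) :=
  [set t | forall i, `|(tnth t i : R) - y i| <= r].

Lemma measurable_tuple_cube n (y : 'I_n -> R) r : measurable (tuple_cube y r).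
Proof.
rewrite (_ : tuple_cube y r = \bigcap_(i in [set: 'I_n])
    (@tnth n (measurableTypeR R) ^~ i @^-1` `[y i - r, y i + r]%classic)).
  apply: fin_bigcap_measurable; first exact: (@finite_finset 'I_n).
  move=> i _; rewrite -[X in measurable X]setTI.
  by apply: measurable_tnth => //; exact: measurable_itv.
apply/seteqP; split=> [t th i _ /=|t th i].
  by rewrite in_itv/= -ler_distlC distrC.
by have := th i I; rewrite /= in_itv/= -ler_distlC distrC.
Qed.

Lemma lebesgue_tuple_cube n (y : 'I_n -> R) r : 0 <= r ->
  lebesgue_tuple R n (tuple_cube y r) = ((2 * r) ^+ n)%:E.
Proof.
move=> r0; elim: n y => [|n IH] y.
  rewrite /= diracE expr0 mem_set//.
  by case.
rewrite /= /lebesgue_cons /pushforward.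
rewrite (_ : _ @^-1` _ = `[y ord0 - r, y ord0 + r]%classic `*`
    tuple_cube (fun i => y (lift ord0 i)) r); last first.
  apply/seteqP; split=> -[x t] /=.
    move=> h; split; first by have := h ord0; rewrite (tnth_nth 0)/= in_itv/= -ler_distlC distrC.
    by move=> i; have := h (lift ord0 i); rewrite !(tnth_nth 0).
  move=> [hx ht] i; case: (unliftP ord0 i) => [j ->|->].
    by have := ht j; rewrite !(tnth_nth 0).
  by move: hx; rewrite (tnth_nth 0)/= in_itv/= -ler_distlC distrC.
rewrite product_measure1E//; last exact: measurable_tuple_cube.
rewrite IH [X in (X * _)%E]lebesgue_measure_itv/= lte_fin.
have [->|rn] := eqVneq r 0.
  by rewrite subr0 addr0 ltxx mul0e mulr0 expr0n.
have rp : 0 < r by rewrite lt_neqAle eq_sym rn.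
rewrite ifT; last by rewrite ltrBlDr -addrA ltrDl addr_gt0.
by rewrite -EFinB -EFinM exprS; congr (_ * _)%:E; ring.
Qed.

Context {d : nat}.

Lemma closed_measurable_rV (C : set 'rV[R]_d) :
  closed C -> measurable (C : set (borel_rV R d)).
Proof.
move=> cC; rewrite -(setCK C); apply: measurableC.
by apply: sub_sigma_algebra; exact: closed_openC.
Qed.

Definition cube (y : 'rV[R]_d) (r : R) : set 'rV[R]_d :=
  [set z | forall i, `|z ord0 i - y ord0 i| <= r].

(** Cubes are the only sets whose volume is computed; a Euclidean ball is compared with a cube
    around it and a cube inside it. *)
Lemma lebesgue_cube (y : 'rV[R]_d) r : 0 <= r ->
  lebesgue_rV (cube y r) = ((2 * r) ^+ d)%:E.
Proof.
move=> r0; rewrite -(lebesgue_tuple_cube (fun i => y ord0 i) r0).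
congr (lebesgue_tuple R d _); apply/seteqP; split=> t /= h i; have := h i;
  by rewrite mxE.
Qed.

Lemma continuous_coord (i : 'I_d) : continuous (fun z : 'rV[R]_d => z ord0 i).
Proof. by move=> z; exact: coord_continuous. Qed.

Lemma continuous_coord_dist (y : 'rV[R]_d) i :
  continuous (fun z : 'rV[R]_d => `|z ord0 i - y ord0 i|).
Proof.
move=> z; apply: (@cvg_norm _ _ _ (nbhs z)); apply: (@cvgB _ _ _ (nbhs z)).
  exact: continuous_coord.
exact: cvg_cst.
Qed.

Lemma closed_cube y r : closed (cube y r).
Proof.
rewrite (_ : cube y r = \bigcap_(i in [set: 'I_d])
    ((fun z : 'rV[R]_d => `|z ord0 i - y ord0 i|) @^-1` [set x | x <= r])).
  apply: closed_bigI => i _; apply: preimage_closed; last exact: closed_le.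
  by move=> z _; exact: continuous_coord_dist.
by apply/seteqP; split=> z h i; [move=> _; exact: h|exact: (h i I)].
Qed.

End volume.

(** * Relative gradients *)

Lemma continuous_sum {R : realType} {T : topologicalType} n (F : 'I_n -> T -> R) :
  (forall i, continuous (F i)) -> continuous (fun x => \sum_(i < n) F i x).
Proof.
move=> cF; rewrite (_ : (fun _ => _) = \sum_(i < n) F i); last first.
  by apply/funext => x; rewrite fct_sumE.
elim/big_ind: _ => [|f g cf cg|//] x; first exact: cvg_cst.
exact: cvgD (cf x) (cg x).
Qed.

Section euclidean_norm.
Context {R : realType} {d : nat}.
Implicit Types (x y g h : 'rV[R]_d).

Lemma enorm_ge0 x : 0 <= enorm x. Proof. exact: sqrtr_ge0. Qed.

Lemma enorm_sqr x : enorm x ^+ 2 = \sum_(i < d) x ord0 i ^+ 2.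
Proof. by rewrite sqr_sqrtr// sumr_ge0// => i _; exact: sqr_ge0. Qed.

Lemma enormZ (s : R) x : enorm (s *: x) = `|s| * enorm x.
Proof.
rewrite /enorm -sqrtr_sqr -sqrtrM ?sqr_ge0//; congr Num.sqrt.
by rewrite mulr_sumr; apply: eq_bigr => i _; rewrite mxE exprMn.
Qed.

Lemma coord_le_enorm x i : `|x ord0 i| <= enorm x.
Proof.
rewrite -sqrtr_sqr ler_wsqrtr// (bigD1 i)//= lerDl sumr_ge0// => j _.
exact: sqr_ge0.
Qed.

Lemma enorm_eq0 x : enorm x = 0 -> x = 0.
Proof.
move=> x0; apply/rowP => i; rewrite mxE; apply/eqP; rewrite -normr_le0 -x0.
exact: coord_le_enorm.
Qed.

Lemma enorm_le x (b : R) : 0 <= b -> (forall i, `|x ord0 i| <= b) ->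
  enorm x <= Num.sqrt d%:R * b.
Proof.
move=> b0 xb; rewrite -[X in _ * X](ger0_norm b0) -sqrtr_sqr -sqrtrM ?ler0n//.
rewrite ler_wsqrtr// -[X in X%:R](card_ord d) mulr_natl -sumr_const.
apply: ler_sum => i _; rewrite -real_normK ?num_real// lerXn2r ?nnegrE//.
Qed.

Lemma continuous_enorm_sub y : continuous (fun x : 'rV[R]_d => enorm (x - y)).
Proof.
move=> x; apply: (@continuous_comp _ _ _
  (fun x : 'rV[R]_d => \sum_(i < d) (x - y) ord0 i ^+ 2 : R) (@Num.sqrt R)); last first.
  exact: sqrt_continuous.
move: x; apply: continuous_sum => i x.
apply: (@continuous_comp _ _ _
  (fun x : 'rV[R]_d => (x - y) ord0 i : R) (fun t => t ^+ 2)); last first.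
  exact: exprn_continuous.
under [X in {for _, continuous X}]eq_fun do rewrite !mxE.
by apply: (@cvgB _ _ _ (nbhs x)); [exact: continuous_coord|exact: cvg_cst].
Qed.

Lemma closed_eball y r : closed (eball y r).
Proof.
apply: (@preimage_closed _ _ (fun x : 'rV[R]_d => enorm (x - y)) [set x | x <= r]).
  by move=> x _; exact: continuous_enorm_sub.
exact: closed_le.
Qed.

Definition dot g h : R := \sum_(i < d) g ord0 i * h ord0 i.

Lemma dotD g1 g2 h : dot (g1 + g2) h = dot g1 h + dot g2 h.
Proof. by rewrite /dot -big_split; apply: eq_bigr => i _; rewrite mxE mulrDl. Qed.

Lemma dotZ (a : R) g h : dot (a *: g) h = a * dot g h.
Proof. by rewrite /dot mulr_sumr; apply: eq_bigr => i _; rewrite mxE mulrA. Qed.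

Lemma dotZr (a : R) g h : dot g (a *: h) = a * dot g h.
Proof. by rewrite /dot mulr_sumr; apply: eq_bigr => i _; rewrite mxE mulrCA. Qed.

Lemma dot0l h : dot 0 h = 0.
Proof. by rewrite /dot big1// => i _; rewrite mxE mul0r. Qed.

Lemma dot_suml n (g : 'I_n -> 'rV[R]_d) h : dot (\sum_i g i) h = \sum_i dot (g i) h.
Proof. by elim/big_rec2: _ => [|i x z _ <-]; rewrite ?dot0l// dotD. Qed.

Lemma dot_sqr_le g h : dot g h ^+ 2 <= enorm g ^+ 2 * enorm h ^+ 2.
Proof. by rewrite !enorm_sqr; exact: CauchySchwarz_sum. Qed.

End euclidean_norm.

Section relative_gradient.
Context {R : realType} {d : nat}.
Variable D : set 'rV[R]_d.
Implicit Types (u w : 'rV[R]_d -> R) (x y g h : 'rV[R]_d).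

Lemma is_grad_grad u x : (exists g, is_grad D u x g) -> is_grad D u x (grad D u x).
Proof. by move=> [g ug]; rewrite /grad; case: xgetP => [y -> //|/(_ g)]. Qed.

Lemma is_gradD u w x g g' : is_grad D u x g -> is_grad D w x g' ->
  is_grad D (fun z => u z + w z) x (g + g').
Proof.
move=> ug wg; rewrite /is_grad.
apply: (@squeeze_cvgr _ _ _ _ (cst 0)
  (fun y => `|u y - u x - dot g (y - x)| / enorm (y - x) +
     `|w y - w x - dot g' (y - x)| / enorm (y - x))); last 2 first.
- exact: cvg_cst.
- by rewrite -[0]addr0; exact: cvgD ug wg.
near=> y; rewrite divr_ge0 ?enorm_ge0//= -mulrDl.
apply: ler_wpM2r; first by rewrite invr_ge0 enorm_ge0.
rewrite -/(dot (g + g') (y - x)) dotD.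
rewrite (_ : _ - _ = (u y - u x - dot g (y - x)) + (w y - w x - dot g' (y - x))); last by ring.
exact: ler_normD.
Unshelve. all: by end_near. Qed.

Lemma is_gradZ (a : R) u x g : is_grad D u x g -> is_grad D (fun z => a * u z) x (a *: g).
Proof.
move=> ug; rewrite /is_grad.
rewrite (_ : (fun _ => _) = (fun y => `|a| * (`|u y - u x - dot g (y - x)| / enorm (y - x)))).
  by rewrite -[0](mulr0 `|a|); apply: cvgM => //; exact: cvg_cst.
apply/funext => y; rewrite -/(dot (a *: g) (y - x)) dotZ mulrA -normrM.
by congr (`|_| / _); ring.
Qed.

Lemma is_grad_cst (c : R) x : is_grad D (fun=> c) x 0.
Proof.
rewrite /is_grad (_ : (fun _ => _) = cst 0); first exact: cvg_cst.
by apply/funext => y; rewrite -/(dot 0 (y - x)) dot0l !subrr normr0 mul0r.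
Qed.

Lemma is_grad_sum n (u : 'I_n -> 'rV[R]_d -> R) x (g : 'I_n -> 'rV[R]_d) :
  (forall i, is_grad D (u i) x (g i)) ->
  is_grad D (fun z => \sum_(i < n) u i z) x (\sum_(i < n) g i).
Proof.
elim: n u g => [|n IH] u g ug.
  rewrite big_ord0 (_ : (fun _ => _) = (fun=> 0)); first exact: is_grad_cst.
  by apply/funext => z; rewrite big_ord0.
rewrite big_ord_recl (_ : (fun _ => _) =
    (fun z => u ord0 z + \sum_(i < n) u (lift ord0 i) z)); last first.
  by apply/funext => z; rewrite big_ord_recl.
by apply: is_gradD => //; exact: IH.
Qed.

Lemma is_grad_approx u x g (e : R) : is_grad D u x g -> 0 < e ->
  \forall y \near nbhs x, D y -> `|u y - u x - dot g (y - x)| <= e * enorm (y - x).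
Proof.
move=> ug e0; have := @cvgr0_norm_le _ R^o _ (within D (nbhs x)) _ _ ug e e0.
move=> /(_ (within_filter _ _)); rewrite near_withinE; apply: (@filterS _ (nbhs x)) => y h Dy.
(* At [y = x] the quotient is 0/0 = 0 and carries no information, but both sides of the claim
   vanish. *)
have [yx|yx] := eqVneq (enorm (y - x)) 0.
  move/enorm_eq0 : yx => /eqP; rewrite subr_eq0 => /eqP ->.
  by rewrite !subrr /dot big1 ?subrr ?normr0 ?mulr_ge0 ?enorm_ge0 ?ltW// => i _; rewrite mxE mulr0.
have p : 0 < enorm (y - x) by rewrite lt_neqAle eq_sym yx enorm_ge0.
have := h Dy; rewrite ger0_norm ?divr_ge0 ?enorm_ge0//.
by rewrite ler_pdivrMr.
Qed.

Lemma segment_cvg y h (s : R) : (fun t : R => y + t *: h) @ s --> y + s *: h.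
Proof.
apply: (@cvgD _ _ _ (nbhs s)); first exact: cvg_cst.
by apply: (@cvgZr_tmp _ _ _ (nbhs s)) => //.
Qed.

(** Differentiability is relative to [D], so at the ends of the segment, possibly on the boundary,
    only continuity is drawn from it. At inner points the restriction to the segment has a two-sided
    derivative, as the mean value theorem asks. *)
Lemma mean_value_bound u (G : 'rV[R]_d -> 'rV[R]_d) y h (L : R) :
  (forall s : R, 0 <= s <= 1 -> D (y + s *: h)) ->
  (forall s : R, 0 <= s <= 1 -> is_grad D u (y + s *: h) (G (y + s *: h))) ->
  (forall s : R, 0 < s < 1 -> `|dot (G (y + s *: h)) h| <= L) ->
  `|u (y + h) - u y| <= L.
Proof.
move=> Dseg ug GL.
pose phi (s : R) := u (y + s *: h).
pose dphi (s : R) := dot (G (y + s *: h)) h.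
(* One estimate serves both the derivative inside and continuity on the closed interval. The
   tolerance is divided by [enorm h + 1], which covers [h = 0]. *)
have approx (s e : R) : 0 <= s <= 1 -> 0 < e -> exists2 r : R, 0 < r & forall t : R,
    `|t - s| < r -> 0 <= t <= 1 ->
    `|phi t - phi s - (t - s) * dphi s| <= e * `|t - s|.
  move=> s01 e0.
  have hp : 0 < enorm h + 1 by rewrite ltr_wpDl ?enorm_ge0.
  have := is_grad_approx (ug s s01) (divr_gt0 e0 hp).
  move=> /(@segment_cvg y h s _)/nbhs_ballP[r r0 rP]; exists r => // t ts t01.
  have := rP t; rewrite /ball/= distrC => /(_ ts (Dseg _ t01)).
  rewrite (_ : y + t *: h - _ = (t - s) *: h); last by rewrite scalerBl opprD addrACA subrr add0r.
  rewrite dotZr enormZ => le; apply: le_trans le _.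
  rewrite -mulrA; apply: ler_wpM2l; first exact: ltW.
  rewrite mulrCA ler_piMr// ler_pdivrMl// mulr1; lra.
have dphiP (s : R) : s \in `]0, 1[%R -> is_derive s 1 phi (dphi s).
  rewrite in_itv/= => /andP[s0 s1].
  have s01 : 0 <= s <= 1 by rewrite !ltW.
  have cv : (fun k => k^-1 *: ((phi \o shift s) (k *: (1 : R)) - phi s)) @ (0 : R)^' --> dphi s.
    apply/cvgrPdist_le => e e0.
    have [r r0 rP] := approx s e s01 e0.
    near=> k.
    have k0 : k != 0 by near: k; exact: nbhs_dnbhs_neq.
    have kr : `|k| < r by near: k; exact: dnbhs0_lt.
    have ks : `|k| < s by near: k; exact: dnbhs0_lt.
    have ks1 : `|k| < 1 - s by near: k; apply: dnbhs0_lt; rewrite subr_gt0.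
    have := rP (k + s); rewrite addrK => /(_ kr).
    have kn := ler_norm k; have kn' := ler_norm (- k); rewrite normrN in kn'.
    have t01 : 0 <= k + s <= 1 by apply/andP; split; lra.
    move=> /(_ t01) le; rewrite /= [_ *: 1]mulr1.
    rewrite (_ : dphi s - _ = - (k^-1 * (phi (k + s) - phi s - k * dphi s))); last first.
      by rewrite /GRing.scale/=; field.
    by rewrite normrN normrM normfV mulrC ler_pdivrMr// normr_gt0.
  by apply: DeriveDef; [exact: (cvgP _ cv)|exact: (cvg_lim _ cv)].
have cphi : {within `[0, 1], continuous phi}.
  apply/subspace_continuousP => s /=; rewrite /= in_itv/= => s01.
  apply/cvgrPdist_le => e e0; rewrite near_withinE.
  have [r r0 rP] := approx s 1 s01 ltr01.
  have dp : 0 < `|dphi s| + 1 by rewrite ltr_wpDl.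
  near=> t => /=; rewrite in_itv/= => t01.
  have tr : `|t - s| < r by rewrite distrC; near: t; exact: nbhsx_ballx.
  have te : `|t - s| < e / (`|dphi s| + 1).
    by rewrite distrC; near: t; apply: nbhsx_ballx; rewrite divr_gt0.
  have := rP t tr t01; rewrite mul1r => le.
  rewrite distrC (_ : phi t - phi s =
    (phi t - phi s - (t - s) * dphi s) + (t - s) * dphi s); last by ring.
  apply: le_trans (ler_normD _ _) _; rewrite normrM.
  move: te; rewrite ltr_pdivlMr// mulrDr mulr1; lra.
have [c c01 cE] := MVT ltr01 dphiP cphi.
move: cE; rewrite subr0 mulr1 /phi scale1r scale0r addr0 => ->.
by apply: GL; move: c01; rewrite in_itv.
Unshelve. all: by end_near. Qed.

End relative_gradient.

(** * Gradient bounds for complex linear combinations *)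

Section gradient_bound.
Context {R : realType} {d N : nat}.
Variables (D : set 'rV[R]_d) (v : 'I_N -> 'rV[R]_d -> R[i]).
Hypothesis v_C1 : forall i,
  C1_on D (fun x => complex.Re (v i x)) /\ C1_on D (fun x => complex.Im (v i x)).

Let gre i x := grad D (fun y => complex.Re (v i y)) x.
Let gim i x := grad D (fun y => complex.Im (v i y)) x.

Lemma grad_sqnorm_ge0 f (x : 'rV[R]_d) : 0 <= grad_sqnorm D f x.
Proof. by rewrite addr_ge0 ?sqr_ge0. Qed.

Lemma grad_norm_ge0 x : 0 <= grad_norm D v x.
Proof. exact: sqrtr_ge0. Qed.

Lemma grad_norm_sqr x : grad_norm D v x ^+ 2 = \sum_(i < N) grad_sqnorm D (v i) x.
Proof. by rewrite sqr_sqrtr// sumr_ge0// => i _; exact: grad_sqnorm_ge0. Qed.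

(* The real function [Re (conj w f)], with [w] the increment of [f], turns the
   bound on the complex increment into the real mean value inequality. *)
Lemma lincomb_mean_value c y h (M : R) : 0 <= M ->
  (forall s : R, 0 <= s <= 1 -> D (y + s *: h)) ->
  (forall s : R, 0 < s < 1 -> grad_norm D v (y + s *: h) <= M) ->
  Normc.normc (lincomb v c (y + h) - lincomb v c y) <=
  Num.sqrt (sqnorm c) * (M * enorm h).
Proof.
move=> M0 Dseg gM.
have normc_conj (z : R[i]) : Normc.normc (conjc z) ^+ 2 = Normc.normc z ^+ 2.
  by rewrite !sqr_normcE; case: z => a b /=; rewrite sqrrN.
have ReMB (z a b : R[i]) :
    complex.Re (z * a) - complex.Re (z * b) = complex.Re (z * (a - b)).
  by case: z a b => [z z'] [a a'] [b b'] /=; ring.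
set w := lincomb v c (y + h) - lincomb v c y.
pose C i := conjc w * c i.
pose u z := \sum_(i < N) (complex.Re (C i) * complex.Re (v i z) +
   - complex.Im (C i) * complex.Im (v i z)).
pose G z := \sum_(i < N) (complex.Re (C i) *: gre i z + - complex.Im (C i) *: gim i z).
have uE z : u z = complex.Re (conjc w * lincomb v c z).
  rewrite /lincomb mulr_sumr Re_sum; apply: eq_bigr => i _; rewrite mulrA -/(C i).
  by case: (C i) (v i z) => [a a'] [b b'] /=; ring.
have uG z : D z -> is_grad D u z (G z).
  move=> Dz; apply: is_grad_sum => i; have [[reg _] [img _]] := v_C1 i.
  by apply: is_gradD; apply: is_gradZ; apply: is_grad_grad; [exact: reg|exact: img].
have L0 : 0 <= Num.sqrt (sqnorm c) * (M * enorm h).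
  by rewrite mulr_ge0 ?sqrtr_ge0// mulr_ge0// enorm_ge0.
have := @mean_value_bound _ _ D u G y h
  (Normc.normc w * (Num.sqrt (sqnorm c) * (M * enorm h))) Dseg.
move=> /(_ (fun s s01 => uG _ (Dseg s s01))).
have bound s : 0 < s < 1 -> `|dot (G (y + s *: h)) h| <=
    Normc.normc w * (Num.sqrt (sqnorm c) * (M * enorm h)).
  move=> s01; set z := y + s *: h.
  (* Complex derivative of [v i] along [h]. Cauchy-Schwarz over [i] separates the coefficients from
     the gradients, which add up to [grad_norm]. *)
  pose Z i := Complex (dot (gre i z) h) (dot (gim i z) h).
  have -> : dot (G z) h = complex.Re (\sum_(i < N) C i * Z i).
    rewrite /G dot_suml Re_sum; apply: eq_bigr => i _; rewrite dotD !dotZ /Z.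
    by case: (C i) => a b /=; ring.
  rewrite -(ler_pXn2r (n := 2)) ?nnegrE//; last by rewrite mulr_ge0 ?normc_ge0.
  rewrite real_normK ?num_real//.
  apply: (@le_trans _ _ (Normc.normc (\sum_(i < N) C i * Z i) ^+ 2)).
    by rewrite sqr_normcE lerDl sqr_ge0.
  apply: le_trans (normc_sum_mul_sqr_le _ _) _.
  have -> : sqnorm C = Normc.normc w ^+ 2 * sqnorm c.
    rewrite /sqnorm mulr_sumr; apply: eq_bigr => i _.
    by rewrite /C Normc.normcM exprMn normc_conj.
  rewrite !exprMn sqr_sqrtr ?sqnorm_ge0// -mulrA.
  apply: ler_wpM2l; first exact: sqr_ge0.
  apply: ler_wpM2l; first exact: sqnorm_ge0.
  apply: (@le_trans _ _ (grad_norm D v z ^+ 2 * enorm h ^+ 2)); last first.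
    apply: ler_wpM2r; first exact: sqr_ge0.
    by rewrite lerXn2r ?nnegrE ?grad_norm_ge0//; exact: gM.
  rewrite grad_norm_sqr mulr_suml; apply: ler_sum => i _.
  by rewrite sqr_normcE /Z/= mulrDl; apply: lerD; exact: dot_sqr_le.
move=> /(_ bound); rewrite !uE.
rewrite ReMB -/w Re_conj_mul.
rewrite ger0_norm ?sqr_ge0// expr2.
have [->//|w0] := eqVneq (Normc.normc w) 0.
by rewrite ler_pM2l// lt_neqAle eq_sym w0 normc_ge0.
Qed.

Lemma continuous_grad_norm : {within D, continuous (grad_norm D v)}.
Proof.
have E : grad_norm D v = fun x => Num.sqrt (\sum_(i < N)
    (\sum_(j < d) (gre i x ord0 j ^+ 2) + \sum_(j < d) (gim i x ord0 j ^+ 2))).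
  by apply/funext => x; congr Num.sqrt; apply: eq_bigr => i _; rewrite -!enorm_sqr.
rewrite E => x; apply: (@continuous_comp (subspace D) R R
  (fun x => \sum_(i < N) (\sum_(j < d) (gre i x ord0 j ^+ 2) +
     \sum_(j < d) (gim i x ord0 j ^+ 2))) (@Num.sqrt R)); last exact: sqrt_continuous.
move: x; apply: (@continuous_sum R (subspace D)) => i.
have [[_ cre] [_ cim]] := v_C1 i.
move=> x; apply: (@cvgD _ _ (subspace D) (nbhs x)).
- move: x; apply: (@continuous_sum R (subspace D)) => j x.
  apply: (@continuous_comp (subspace D) R R (fun x => gre i x ord0 j) (fun t => t ^+ 2)).
    exact: cre.
  exact: exprn_continuous.
- move: x; apply: (@continuous_sum R (subspace D)) => j x.
  apply: (@continuous_comp (subspace D) R R (fun x => gim i x ord0 j) (fun t => t ^+ 2)).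
    exact: cim.
  exact: exprn_continuous.
Qed.

End gradient_bound.

(** * Weighted coverings *)

Section covering_radius.
Context {R : realType} {d : nat}.
Variables (D : set 'rV[R]_d) (g : 'rV[R]_d -> R).
Hypothesis cD : convex_set (D : set (convex_lmodType 'rV[R]_d)).
Hypothesis kD : compact D.
Hypothesis g_gt0 : forall x, D x -> 0 < g x.
Hypothesis cg : {within D, continuous g}.

Lemma convex_segment y x (s : R) : D y -> D x -> 0 <= s <= 1 ->
  D (y + s *: (x - y)).
Proof.
move=> Dy Dx /andP[s0 s1].
have := cD (Itv01 s0 s1) (mem_set Dx) (mem_set Dy); rewrite inE.
congr (D _); rewrite /conv/= [X in _ + X *: _](_ : _ = 1 - s)// scalerBr scalerBl scale1r.
by rewrite addrC -addrA [X in _ = _ + X]addrC.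
Qed.

Local Notation f := (fun x => (g x)^-1).
Local Notation gmax := (sup [set g x | x in D]).
Local Notation eps := ((3 * gmax)^-1).
Local Notation rad := (cover_radius D f eps).

Let fS c y := [set f z | z in eball y c `&` D].

Lemma g_le_sup x : D x -> g x <= gmax.
Proof.
move=> Dx; apply: ub_le_sup; last by exists x.
have [z _ zmax] := @compact_EVT_max _ _ g D (ex_intro _ x Dx) kD cg.
by exists (g z) => _ [w Dw <-]; apply: zmax; exact: mem_set.
Qed.

Lemma sup_g_gt0 x : D x -> 0 < gmax.
Proof. by move=> Dx; apply: lt_le_trans (g_gt0 Dx) (g_le_sup Dx). Qed.

Lemma f_gt0 x : D x -> 0 < f x.
Proof. by move=> Dx; rewrite invr_gt0 g_gt0. Qed.

Lemma inf_f x : D x -> inf [set f z | z in D] = gmax^-1.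
Proof.
move=> Dx; have gm := sup_g_gt0 Dx; apply/eqP; rewrite eq_le; apply/andP; split.
- rewrite -[leLHS]invrK lef_pV2 ?posrE ?invr_gt0//; last first.
    apply: lt_le_trans (lb_le_inf (x := gmax^-1) _ _); first by rewrite invr_gt0.
      by exists (f x), x.
    by move=> _ [z Dz <-]; rewrite lef_pV2 ?posrE ?g_gt0// g_le_sup.
  apply: ge_sup; first by exists (g x), x.
  move=> _ [z Dz <-]; rewrite -[leLHS]invrK lef_pV2 ?posrE ?invr_gt0 ?g_gt0//; last first.
    apply: lt_le_trans (lb_le_inf (x := gmax^-1) _ _); first by rewrite invr_gt0.
      by exists (f x), x.
    by move=> _ [w Dw <-]; rewrite lef_pV2 ?posrE ?g_gt0// g_le_sup.
  apply: ge_inf; last by exists z.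
  by exists 0 => _ [w Dw <-]; rewrite ltW// f_gt0.
- apply: lb_le_inf; first by exists (f x), x.
  by move=> _ [z Dz <-]; rewrite lef_pV2 ?posrE ?g_gt0// g_le_sup.
Qed.

Lemma fS_lb c y : has_lbound (fS c y).
Proof. by exists 0 => _ [z [_ Dz] <-]; rewrite ltW// f_gt0. Qed.

Lemma fS_mem c y : D y -> 0 <= c -> fS c y (f y).
Proof.
move=> Dy c0; exists y => //; split => //.
by rewrite /eball/= subrr -(scale0r y) enormZ normr0 mul0r.
Qed.

(** With f = 1/g the minimum of f is 1/gmax, so [eps] is a third of it: the normalization cancels
    and the radius at [y] is governed by the values of f near [y]. *)
Lemma eps_relative_min c y : D y ->
  eps * relative_min D f c y = inf (fS c y) / 3.
Proof.
move=> Dy; rewrite /relative_min (inf_f Dy) invrK -/(fS c y).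
by field; rewrite gt_eqF// (sup_g_gt0 Dy).
Qed.

Let radS y := [set Num.min (eps * relative_min D f c y) c | c in [set c | 0 <= c]].

Lemma radS_ub y : D y -> ubound (radS y) (f y / 3).
Proof.
move=> Dy _ [c c0 <-]; rewrite ge_min; apply/orP; left.
rewrite eps_relative_min// ler_wpM2r//.
by apply: ge_inf; [exact: fS_lb|exact: fS_mem].
Qed.

Lemma min_le_rad y c : D y -> 0 <= c -> Num.min (inf (fS c y) / 3) c <= rad y.
Proof.
move=> Dy c0; apply: ub_le_sup; first by exists (f y / 3); exact: radS_ub.
by exists c => //; rewrite eps_relative_min.
Qed.

Lemma cover_radius_gt0 y : D y -> 0 < rad y.
Proof.
move=> Dy; have gm := sup_g_gt0 Dy.
have e0 : 0 < eps by rewrite invr_gt0 mulr_gt0.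
apply: lt_le_trans (min_le_rad Dy (ltW e0)); rewrite lt_min e0 andbT.
apply: divr_gt0 => //; apply: lt_le_trans (_ : 0 < gmax^-1) _; first by rewrite invr_gt0.
apply: lb_le_inf; first by exists (f y); apply: fS_mem => //; exact: ltW.
by move=> _ [z [_ Dz] <-]; rewrite lef_pV2 ?posrE ?g_gt0// g_le_sup.
Qed.

(** If [f x < 3 * rad y], some [c] beyond both [enorm (x - y)] and [f x / 3] has the infimum of f
    over its ball above [f x], yet [x] lies in that ball. *)
Lemma open_ball_le y x : D y -> D x -> enorm (x - y) < rad y -> 3 * rad y <= f x.
Proof.
move=> Dy Dx xy; rewrite leNgt; apply/negP => fx.
have lt : Num.max (enorm (x - y)) (f x / 3) < rad y.
  by rewrite gt_max xy/= ltr_pdivrMr// mulrC.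
have [|_ [c c0 <-]] := sup_gt _ lt.
  by exists (Num.min (eps * relative_min D f 0 y) 0), 0 => /=.
rewrite lt_min eps_relative_min// !gt_max => /andP[/andP[_ h1] /andP[h2 _]].
move: h1; rewrite ltr_pM2r// ltNge => /negP; apply.
by apply: ge_inf; [exact: fS_lb|exists x => //; split => //; exact: ltW].
Qed.

(** A point on the sphere is approached along the segment from [y], which convexity keeps in [D] and
    whose earlier points lie in the open ball; continuity of [g] concludes. *)
Lemma cover_ball_le y x : D y -> D x -> enorm (x - y) <= rad y -> 3 * rad y <= f x.
Proof.
move=> Dy Dx xy; have r0 := cover_radius_gt0 Dy.
rewrite leNgt; apply/negP => fx.
have gx : (3 * rad y)^-1 < g x.
  by rewrite -[ltRHS]invrK ltf_pV2 ?posrE ?mulr_gt0// f_gt0.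
have cgx : g @ within D (nbhs x) --> g x by move/subspace_continuousP : cg; exact.
have := cvgr_gt (g x) cgx _ gx; rewrite near_withinE => near_x.
have : \forall s \near (1 : R), D (y + s *: (x - y)) -> (3 * rad y)^-1 < g (y + s *: (x - y)).
  have := @segment_cvg R d y (x - y) 1 (fun z => D z -> (3 * rad y)^-1 < g z).
  by rewrite scale1r [y + _]addrC subrK; apply; exact: near_x.
move=> /nbhs_ballP[e /= e0 eP].
(* Within [e] of 1, and at least 1/2 so that the point stays on the segment. *)
pose s := 1 - Num.min (1 / 2) (e / 2).
have me : 0 < Num.min (1 / 2) (e / 2) by rewrite lt_min !divr_gt0.
have s01 : 0 <= s <= 1.
  have : Num.min (1 / 2) (e / 2) <= 1 / 2 by rewrite ge_min lexx.
  by rewrite /s; move=> h; apply/andP; split; lra.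
have s1 : s < 1 by rewrite /s ltrBlDr ltrDl.
have Ds := convex_segment Dy Dx s01.
have := eP s _ Ds; rewrite /ball/= => /(_ _) h.
have {}h : (3 * rad y)^-1 < g (y + s *: (x - y)).
  apply: h; rewrite /s opprB addrC subrK gtr0_norm//.
  by rewrite gt_min orbC ltr_pdivrMr// ltr_pMr// ltr1n.
have : 3 * rad y <= f (y + s *: (x - y)).
  apply: open_ball_le => //; rewrite addrAC subrr add0r enormZ.
  case/andP: s01 => s0 _; rewrite ger0_norm//.
  have [->|ne] := eqVneq (enorm (x - y)) 0; first by rewrite mulr0.
  apply: lt_le_trans xy; rewrite gtr_pMl// lt_neqAle eq_sym ne; exact: enorm_ge0.
rewrite leNgt => /negP; apply.
by rewrite -[ltRHS]invrK ltf_pV2 ?posrE ?invr_gt0 ?mulr_gt0// g_gt0.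
Qed.

(* Minimizing [max |z - y| r + max (f z) (3 r)] over [D]: as [c] decreases to
   the radius [r] its infimum is [4 r], and compactness attains it. *)
Lemma cover_ball_attained y : D y ->
  exists2 z, D z & enorm (z - y) <= rad y /\ f z <= 3 * rad y.
Proof.
move=> Dy; set r := rad y; have r0 : 0 < r := cover_radius_gt0 Dy.
pose F z := Num.max (enorm (z - y)) r + Num.max (f z) (3 * r).
have cF : {within D, continuous F}.
  have cmax (c : R) : continuous (fun t : R => Num.max t c).
    by move=> t; apply: (@continuous_max R R id (fun=> c) t); [exact: cvg_id|exact: cvg_cst].
  apply/subspace_continuousP => x Dx; apply: (@cvgD _ _ _ (within D (nbhs x))).
    apply: (@continuous_cvg _ _ _ _ (within_filter _ _)
      (fun z => enorm (z - y)) (fun t => Num.max t r)).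
      exact: cmax.
    by apply: cvg_within_filter; exact: continuous_enorm_sub.
  apply: (@continuous_cvg _ _ _ _ (within_filter _ _) f (fun t => Num.max t (3 * r))).
    exact: cmax.
  apply: (@cvgV _ _ (within D (nbhs x))); first by rewrite gt_eqF// g_gt0.
  by move/subspace_continuousP : cg; exact.
have [z zD zmin] := compact_EVT_min (ex_intro _ y Dy) kD cF.
exists z; first by rewrite inE in zD.
(* The two maxima are at least [r] and [3 * r], so a total of [4 * r] forces equality in both. *)
suff Fz : F z <= 4 * r.
  have h1 : r <= Num.max (enorm (z - y)) r by rewrite le_max lexx orbT.
  have h2 : 3 * r <= Num.max (f z) (3 * r) by rewrite le_max lexx orbT.
  have h3 : enorm (z - y) <= Num.max (enorm (z - y)) r by rewrite le_max lexx.
  have h4 : f z <= Num.max (f z) (3 * r) by rewrite le_max lexx.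
  by rewrite /F in Fz; split; lra.
apply/ler_addgt0Pr => e e0.
have c0 : 0 <= r + e / 2 by rewrite addr_ge0 ?divr_ge0// ltW.
(* Since [c = r + e / 2] exceeds the radius, the minimum in [min_le_rad] cannot be [c]. *)
have : inf (fS (r + e / 2) y) < 3 * r + e / 2.
  have := min_le_rad Dy c0; rewrite -/r ge_min => /orP[|]; last by lra.
  by rewrite ler_pdivrMr//; lra.
move=> /inf_lt [|_ [x [xy Dx] <-] fx].
  by exists (f y); exact: fS_mem.
apply: le_trans (zmin x (mem_set Dx)) _; rewrite /F.
have h1 : Num.max (enorm (x - y)) r <= r + e / 2.
  by rewrite ge_max xy/= lerDl divr_ge0// ltW.
have h2 : Num.max (f x) (3 * r) <= 3 * r + e / 2.
  by rewrite ge_max ltW//= lerDl divr_ge0// ltW.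
lra.
Qed.

End covering_radius.

(** * Cubes inside balls of a convex body *)

Section convex_volume.
Context {R : realType} {d : nat}.
Variable D : set 'rV[R]_d.
Hypothesis cD : convex_set (D : set (convex_lmodType 'rV[R]_d)).
Hypothesis kD : compact D.
Hypothesis iD : interior D !=set0.

Lemma compact_enorm_bound : exists2 B : R, 0 <= B & forall x, D x -> enorm x <= B.
Proof.
have [[x0 Dx0]|/set0P/negP] := pselect (D !=set0); last first.
  by rewrite negbK => /eqP ->; exists 0.
have cE : {within D, continuous (fun x : 'rV[R]_d => enorm (x - 0))}.
  by apply: continuous_subspaceT; exact: continuous_enorm_sub.
have [z _ zmax] := compact_EVT_max (ex_intro _ x0 Dx0) kD cE.
exists (enorm (z - 0)); first exact: enorm_ge0.
by move=> x Dx; rewrite -[x]subr0; exact: zmax (mem_set Dx).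
Qed.

(* The contraction of [D] towards [y] by the factor [s] lies in both the ball
   of radius [s M] and [D], and contains a cube of half-side [s rho]. *)
Lemma convex_ball_volume : exists rho M : R, [/\ 0 < rho, 0 < M,
  forall y, D y -> D `<=` eball y M &
  forall y s, D y -> 0 < s <= 1 ->
    cube (y + s *: (get (interior D) - y)) (s * rho) `<=` eball y (s * M) `&` D].
Proof.
have [B B0 DB] := compact_enorm_bound.
set x0 := get _; have : (interior D) x0 by exact: getPex.
move=> /nbhs_ballP[e /= e0 eD].
(* Half of [e] because the neighbourhood is an open sup-norm ball and the cube is closed; the term 1
   keeps [M] positive also for [d = 0]. *)
exists (e / 2), (Num.sqrt d%:R * (2 * B) + 1).
have DM y z : D y -> D z -> enorm (z - y) <= Num.sqrt d%:R * (2 * B) + 1.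
  move=> Dy Dz; apply: (@le_trans _ _ (Num.sqrt d%:R * (2 * B))); last by rewrite lerDl.
  apply: enorm_le; first by rewrite mulr_ge0.
  move=> i; rewrite !mxE; apply: le_trans (ler_normB _ _) _.
  have := le_trans (coord_le_enorm z i) (DB _ Dz).
  have := le_trans (coord_le_enorm y i) (DB _ Dy); lra.
split.
- by rewrite divr_gt0.
- by rewrite ltr_wpDl// mulr_ge0 ?sqrtr_ge0 ?mulr_ge0.
- by move=> y Dy z Dz; exact: DM.
move=> y s Dy /andP[s0 s1] z zc.
pose w := y + s^-1 *: (z - y).
have sn : s != 0 by rewrite gt_eqF.
have Dw : D w.
  apply: eD; split => // i j; rewrite (ord1 i) /ball/= /w !mxE.
  have := zc j; rewrite !mxE => zj.
  rewrite (_ : x0 ord0 j - _ =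
      - (s^-1 * (z ord0 j - (y ord0 j + s * (x0 ord0 j - y ord0 j))))); last first.
    by field.
  rewrite normrN normrM gtr0_norm ?invr_gt0// ltr_pdivrMl//.
  apply: le_lt_trans zj _; rewrite ltr_pM2l//.
  by rewrite ltr_pdivrMr// ltr_pMr// ltr1n.
have zE : z = y + s *: (w - y).
  by rewrite /w addrAC subrr add0r scalerA mulfV// scale1r addrC subrK.
split; last by rewrite zE; apply: convex_segment => //; rewrite ltW.
rewrite /eball/= {1}zE addrAC subrr add0r enormZ gtr0_norm//.
by rewrite ler_pM2l// DM.
Qed.

End convex_volume.

Lemma within_continuous_measurable {R : realType} {d : nat}
    (D : set 'rV[R]_d) (g : 'rV[R]_d -> R) :
  closed D -> {within D, continuous g} ->
  measurable_fun (D : set (borel_rV R d)) g.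
Proof.
move=> clD cg; apply: (measurability _ (RGenOInfty.measurableE R)).
move=> _ [_ [x ->] <-].
have : open (g @^-1` `]x, +oo[%classic : set (subspace D)).
  by move/continuousP : cg; apply; rewrite set_itvE; exact: open_gt.
move=> /open_subspaceP[W oW WE]; rewrite setIC -WE setIC.
apply: measurableI; first exact: closed_measurable_rV.
exact: sub_sigma_algebra.
Qed.

(** * Integrals of the density over covering balls *)

Section ball_measure.
Context {R : realType} {d : nat}.
Variables (D : set 'rV[R]_d) (g : 'rV[R]_d -> R).
Hypothesis cD : convex_set (D : set (convex_lmodType 'rV[R]_d)).
Hypothesis kD : compact D.
Hypothesis g_gt0 : forall x, D x -> 0 < g x.
Hypothesis cg : {within D, continuous g}.

Local Notation f := (fun x => (g x)^-1).
Local Notation eps := ((3 * sup [set g x | x in D])^-1).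
Local Notation rad := (cover_radius D f eps).

Variable A : {fset 'rV[R]_d}.
Hypothesis covA : weighted_covering D f eps A.
Local Notation G := (distortion D f eps A).

(** Ratios of g = 1/f are inverse ratios of f, hence bounded by sup f / inf f over the ball. *)
Lemma distortion_le y x z : y \in A -> D x -> D z ->
  enorm (x - y) <= rad y -> enorm (z - y) <= rad y -> g z ^+ d <= G * g x ^+ d.
Proof.
move=> yA Dx Dz xy zy.
set S := [set f x | x in eball y (rad y) `&` D].
have [w wD wmin] := compact_EVT_min (ex_intro _ x Dx) kD cg.
rewrite inE in wD.
have Sub : has_ubound S.
  exists (f w) => _ [u [_ Du] <-]; rewrite lef_pV2 ?posrE ?g_gt0//.
  by apply: wmin; exact: mem_set.
have gm := sup_g_gt0 kD g_gt0 cg Dx.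
have Sinf : 0 < inf S.
  apply: (@lt_le_trans _ _ (sup [set g x | x in D])^-1); first by rewrite invr_gt0.
  apply: lb_le_inf; first by exists (f x), x.
  by move=> _ [u [_ Du] <-]; rewrite lef_pV2 ?posrE ?g_gt0// (g_le_sup kD cg).
have fx : f x <= sup S by apply: ub_le_sup => //; exists x.
have fz : inf S <= f z.
  by apply: ge_inf; [exists 0 => _ [u [_ Du] <-]; rewrite invr_ge0 ltW// g_gt0|exists z].
have gx0 := g_gt0 Dx; have gz0 := g_gt0 Dz.
have le1 : g z <= sup S / inf S * g x.
  rewrite -ler_pdivrMr// ler_pdivlMr//.
  apply: le_trans fx; rewrite mulrAC -[leRHS]mul1r.
  apply: ler_wpM2r; first by rewrite invr_ge0 ltW.
  rewrite -(mulfV (lt0r_neq0 gz0)); apply: ler_wpM2l => //; exact: ltW.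
have Q0 : 0 <= sup S / inf S.
  by apply: divr_ge0; [apply: le_trans fx; rewrite invr_ge0 ltW|exact: ltW].
apply: (@le_trans _ _ ((sup S / inf S) ^+ d * g x ^+ d)).
  rewrite -exprMn; apply: lerXn2r; rewrite ?nnegrE; [exact: ltW| |exact: le1].
  by rewrite mulr_ge0// ltW.
apply: ler_wpM2r; first by rewrite exprn_ge0// ltW.
rewrite /distortion.
exact: (@le_bigmax_seq _ _ _ _ _ y xpredT (fun y =>
  (sup [set f x | x in eball y (rad y) `&` D] /
   inf [set f x | x in eball y (rad y) `&` D]) ^+ d)).
Qed.

Lemma center_mem y : y \in A -> D y.
Proof. by case: covA => + _ => /(_ y). Qed.

Lemma enorm_subrr (y : 'rV[R]_d) : enorm (y - y) = 0.
Proof. by rewrite subrr -(scale0r y) enormZ normr0 mul0r. Qed.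

Lemma distortion_ge1 y : y \in A -> 1 <= G.
Proof.
move=> yA; have Dy := center_mem yA.
have r0 := cover_radius_gt0 kD g_gt0 cg Dy.
have := distortion_le yA Dy Dy; rewrite enorm_subrr => /(_ (ltW r0) (ltW r0)).
by rewrite -[leLHS]mul1r ler_pM2r// exprn_gt0// g_gt0.
Qed.

Let clD : closed D.
Proof. by apply: compact_closed => //; exact: norm_hausdorff. Qed.

Let mD : measurable (D : set (borel_rV R d)). Proof. exact: closed_measurable_rV. Qed.

Lemma measurable_ball_inter y r :
  measurable (eball y r `&` D : set (borel_rV R d)).
Proof. by apply: closed_measurable_rV; apply: closedI => //; exact: closed_eball. Qed.

Lemma measurable_density : measurable_fun (D : set (borel_rV R d)) (fun x => (g x ^+ d)%:E).
Proof.
by apply/measurable_EFinP; apply: measurable_funX; exact: within_continuous_measurable.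
Qed.

(** The density is at most (3 r)^-d on the ball, which lies in a cube of volume (2 r)^d; the product
    is (2/3)^d. *)
Lemma ball_integral_le y : y \in A ->
  (\int[lebesgue_rV]_(x in eball y (rad y) `&` D) (g x ^+ d)%:E <= 1)%E.
Proof.
move=> yA; have Dy := center_mem yA.
have r0 := cover_radius_gt0 kD g_gt0 cg Dy.
apply: (@le_trans _ _ (\int[lebesgue_rV]_(x in eball y (rad y) `&` D)
    (((3 * rad y)^-1) ^+ d)%:E)%E).
  apply: ge0_le_integral => //.
  - exact: measurable_ball_inter.
  - by move=> x [_ Dx]; rewrite lee_fin exprn_ge0// ltW// g_gt0.
  - apply: (measurable_funS mD) => //; exact: measurable_density.
  - move=> x [xy Dx]; rewrite lee_fin; apply: lerXn2r; rewrite ?nnegrE.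
    + by rewrite ltW// g_gt0.
    + by rewrite invr_ge0 mulr_ge0// ltW.
    have := cover_ball_le cD kD g_gt0 cg Dy Dx xy => le.
    by rewrite -[leLHS]invrK lef_pV2 ?posrE ?invr_gt0 ?mulr_gt0 ?g_gt0.
rewrite integral_cst; last exact: measurable_ball_inter.
apply: (@le_trans _ _ ((((3 * rad y)^-1) ^+ d)%:E * lebesgue_rV (cube y (rad y)))%E).
  apply: lee_wpmul2l; first by rewrite lee_fin exprn_ge0// invr_ge0 mulr_ge0// ltW.
  apply: le_measure; rewrite ?inE.
  - exact: measurable_ball_inter.
  - by apply: closed_measurable_rV; exact: closed_cube.
  - move=> x [xy _] i; apply: le_trans xy; apply: le_trans (coord_le_enorm _ i).
    by rewrite !mxE.
rewrite (lebesgue_cube _ (ltW r0)) -EFinM lee_fin -exprMn; apply: exprn_ile1.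
  by rewrite mulr_ge0 ?invr_ge0 ?mulr_ge0// ltW.
by rewrite ler_pdivrMl ?mulr_gt0// mulr1 ler_pM2r// ler_nat.
Qed.

Lemma total_integral_le :
  (\int[lebesgue_rV]_(x in D) (g x ^+ d)%:E <= (#|` A|%:R)%:E)%E.
Proof.
have f0 B x : (0 <= ((fun x => (g x ^+ d)%:E) \_ (B `&` D)) x)%E.
  by apply: erestrict_ge0 => z [_ Dz]; rewrite lee_fin exprn_ge0// ltW// g_gt0.
have mf y : measurable_fun [set: borel_rV R d]
    ((fun x => (g x ^+ d)%:E) \_ (eball y (rad y) `&` D)).
  have mB := measurable_ball_inter y (rad y).
  apply: (iffLR (@measurable_restrictT _ _ (borel_rV R d) _ _ (fun x => (g x ^+ d)%:E) mB)).
  by apply: (measurable_funS mD) => //; exact: measurable_density.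
apply: (@le_trans _ _ (\int[lebesgue_rV]_x (\sum_(y <- A)
    ((fun x => (g x ^+ d)%:E) \_ (eball y (rad y) `&` D)) x))%E).
  rewrite integral_mkcond; apply: ge0_le_integral => //.
  - by move=> x _; have := f0 setT x; rewrite setTI.
  - apply: (iffLR (@measurable_restrictT _ _ (borel_rV R d) _ _ (fun x => (g x ^+ d)%:E) mD)).
    exact: measurable_density.
  - by apply: emeasurable_sum.
  - move=> x _; rewrite patchE; case: ifPn => xD; last first.
      by apply: sume_ge0 => y _; exact: f0.
    (* The covering may use smaller radii; enlarging them to the full covering radius still covers
       [D]. *)
    rewrite inE in xD; case: covA => _ [r [rP /(_ x xD)[y yA xy]]].
    rewrite (big_fsetD1 y)//= patchE mem_set.
      by rewrite leeDl// sume_ge0// => z _; exact: f0.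
    split => //; apply: le_trans xy _.
    by case/andP: (rP _ yA).
rewrite ge0_integral_sum//.
apply: (@le_trans _ _ (\sum_(y <- A) 1)%E).
  rewrite big_seq [leRHS]big_seq; apply: lee_sum => y yA.
  by rewrite -integral_mkcond; exact: ball_integral_le.
by rewrite (eq_bigr (fun=> (1 : R)%:E))// sumEFin card_fset_sum1 natr_sum.
Qed.

End ball_measure.

(** * Random admissible meshes *)

Section ball_probability.
Context {R : realType} {d : nat}.
Variables (D : set 'rV[R]_d) (g : 'rV[R]_d -> R).
Hypothesis cD : convex_set (D : set (convex_lmodType 'rV[R]_d)).
Hypothesis kD : compact D.
Hypothesis g_gt0 : forall x, D x -> 0 < g x.
Hypothesis cg : {within D, continuous g}.

Local Notation f := (fun x => (g x)^-1).
Local Notation eps := ((3 * sup [set g x | x in D])^-1).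
Local Notation rad := (cover_radius D f eps).

Variable A : {fset 'rV[R]_d}.
Hypothesis covA : weighted_covering D f eps A.
Local Notation G := (distortion D f eps A).

Variables (rho M : R).
Hypothesis rho_gt0 : 0 < rho.
Hypothesis M_gt0 : 0 < M.
Hypothesis DM : forall y, D y -> D `<=` eball y M.
Hypothesis cubeD : forall y s, D y -> 0 < s <= 1 ->
  cube (y + s *: (get (interior D) - y)) (s * rho) `<=` eball y (s * M) `&` D.

Local Notation c0 := (Num.min 1 ((2 * rho / (3 * M)) ^+ d)).
Local Notation J E := (\int[lebesgue_rV]_(x in E) (g x ^+ d)%:E)%E.

(** Somewhere in the ball [g] reaches 1/(3 r), and the distortion spreads this value over the whole
    ball at the cost of [G]. *)
Lemma ball_integral_ge y C s : y \in A -> 0 <= s ->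
  cube C s `<=` eball y (rad y) `&` D ->
  (((2 * s) ^+ d / (G * (3 * rad y) ^+ d))%:E <= J (eball y (rad y) `&` D))%E.
Proof.
move=> yA s0 sub; have Dy := center_mem covA yA.
have r0 := cover_radius_gt0 kD g_gt0 cg Dy.
have G1 : 1 <= G := distortion_ge1 kD g_gt0 cg covA yA.
have G0 : 0 < G := lt_le_trans ltr01 G1.
have [z Dz [zy fz]] := cover_ball_attained kD g_gt0 cg Dy.
have mB := measurable_ball_inter kD y (rad y).
have gz : (3 * rad y)^-1 <= g z.
  by rewrite -[leRHS]invrK lef_pV2 ?posrE ?invr_gt0 ?mulr_gt0 ?g_gt0.
apply: (@le_trans _ _ (\int[lebesgue_rV]_(x in eball y (rad y) `&` D)
    ((G * (3 * rad y) ^+ d)^-1)%:E)%E).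
  rewrite integral_cst// mulrC EFinM; apply: lee_wpmul2l.
    by rewrite lee_fin invr_ge0 mulr_ge0 ?exprn_ge0 ?mulr_ge0// ltW.
  rewrite -(lebesgue_cube C s0); apply: le_measure; rewrite ?inE//.
  by apply: closed_measurable_rV; exact: closed_cube.
apply: ge0_le_integral => //.
- by move=> x _; rewrite lee_fin invr_ge0 mulr_ge0 ?exprn_ge0 ?mulr_ge0// ltW.
- by apply: (measurable_funS _ _ (measurable_density kD cg)) => //;
    apply: closed_measurable_rV; apply: compact_closed => //; exact: norm_hausdorff.
- move=> x [xy Dx]; rewrite lee_fin.
  have := distortion_le kD g_gt0 cg yA Dx Dz xy zy => le.
  rewrite invfM ler_pdivrMl//; apply: le_trans le.
  rewrite -exprVn; apply: lerXn2r; rewrite ?nnegrE//.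
    by rewrite invr_ge0 mulr_ge0// ltW.
  by rewrite ltW// g_gt0.
Qed.

(** The radius cancels: the inner cube has half-side proportional to [rad y] and the density is at
    least (3 rad y)^-d / G, which leaves (2 rho / (3 M))^d / G. The minimum with 1 in the constant
    serves balls that swallow [D], where the ratio is 1. *)
Lemma ball_ratio_ge y : y \in A ->
  ((c0 / (#|` A|%:R * G))%:E <= J (eball y (rad y) `&` D) / J D)%E.
Proof.
move=> yA; have Dy := center_mem covA yA.
have r0 := cover_radius_gt0 kD g_gt0 cg Dy.
have G1 : 1 <= G := distortion_ge1 kD g_gt0 cg covA yA.
have G0 : 0 < G := lt_le_trans ltr01 G1.
have A1 : 1 <= #|` A|%:R :> R.
  by rewrite ler1n cardfs_gt0; apply/fset0Pn; exists y.
have A0 : 0 < #|` A|%:R :> R := lt_le_trans ltr01 A1.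
have mB := measurable_ball_inter kD y (rad y).
have mD : measurable (D : set (borel_rV R d)).
  by apply: closed_measurable_rV; apply: compact_closed => //; exact: norm_hausdorff.
have JA : (J D <= (#|` A|%:R)%:E)%E := total_integral_le cD kD g_gt0 cg covA.
have BD : (J (eball y (rad y) `&` D) <= J D)%E.
  apply: ge0_subset_integral => //.
  - exact: measurable_density.
  - by move=> x Dx; rewrite lee_fin exprn_ge0// ltW// g_gt0.
have q0 : 0 < (2 * rho / (3 * M)) ^+ d by rewrite exprn_gt0// divr_gt0// mulr_gt0.
have c00 : 0 < c0 by rewrite lt_min ltr01.
have c01 : c0 <= 1 by rewrite ge_min lexx.
have cE (a b r' s' : R) : r' != 0 -> s' != 0 -> 3 != 0 :> R ->
    (2 * (r' / s' * a)) ^+ d / (b * (3 * r') ^+ d) = (2 * a / (3 * s')) ^+ d / b.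
  move=> ? ? ?; set Z := 2 * _; set Y := 3 * r'.
  transitivity (Z ^+ d / Y ^+ d / b); first by rewrite invfM mulrA mulrAC.
  rewrite -expr_div_n; congr (_ ^+ d / b).
  by rewrite /Z /Y; field; apply/andP.
have [rM|Mr] := leP (rad y) M.
  have s01 : 0 < rad y / M <= 1 by rewrite divr_gt0//= ler_pdivrMr// mul1r.
  have b_ge : ((c0 / G)%:E <= J (eball y (rad y) `&` D))%E.
    apply: (@le_trans _ _ (((2 * (rad y / M * rho)) ^+ d / (G * (3 * rad y) ^+ d))%:E)).
      rewrite lee_fin cE ?gt_eqF//; apply: ler_wpM2r; first by rewrite invr_ge0 ltW.
      by rewrite ge_min lexx orbT.
    apply: (@ball_integral_ge _ (y + (rad y / M) *: (get (interior D) - y))) => //.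
      by rewrite ltW// mulr_gt0// divr_gt0.
    by have := cubeD Dy s01; rewrite divfK// gt_eqF.
  have cG : 0 < c0 / G by rewrite divr_gt0.
  move: b_ge BD JA; case: (J (eball y (rad y) `&` D)) => [b| |]//; case: (J D) => [j| |]//.
  rewrite !lee_fin => cb bj jA; have j0 : 0 < j by lra.
  rewrite inver gt_eqF// -EFinM lee_fin.
  rewrite (_ : c0 / (_ * G) = c0 / G / #|` A|%:R); last first.
    by rewrite -[RHS]mulrA -invfM [G * _]mulrC.
  apply: ler_pM; [exact: ltW|by rewrite invr_ge0 ltW|exact: cb|].
  by rewrite lef_pV2 ?posrE.
have BDE : eball y (rad y) `&` D = D.
  by apply/setIidPr => x Dx; apply: (@le_trans _ _ M); [exact: DM|exact: ltW].
have sub1 : cube (y + 1 *: (get (interior D) - y)) rho `<=` eball y (rad y) `&` D.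
  have s1 : 0 < (1 : R) <= 1 by rewrite ltr01 lexx.
  by have := cubeD Dy s1; rewrite !mul1r BDE => h x /h[].
(* The quotient of [J D] by itself is 1 only if [J D] is positive and finite; the cube gives the
   first, [JA] the second. *)
have h := ball_integral_ge yA (ltW rho_gt0) sub1.
rewrite BDE in h.
have pos : 0 < (2 * rho) ^+ d / (G * (3 * rad y) ^+ d).
  by rewrite divr_gt0 ?mulr_gt0 ?exprn_gt0 ?mulr_gt0.
rewrite BDE; move: h JA; case: (J D) => [j| |]//; rewrite !lee_fin => hj jA.
have j0 : 0 < j by lra.
rewrite inver gt_eqF// -EFinM lee_fin mulfV ?gt_eqF//.
rewrite ler_pdivrMr ?mulr_gt0// mul1r; apply: le_trans c01 _.
by rewrite -[leLHS]mul1r; apply: ler_pM.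
Qed.

End ball_probability.

Section covering_events.
Context {R : realType} {disp dT : measure_display} {Om : measurableType disp}
  {T : measurableType dT} (P : probability Om R) {I : choiceType}.

Lemma probability_bigsetU_le (s : seq I) (F : I -> set Om) :
  (forall i, measurable (F i)) ->
  (P (\big[setU/set0]_(i <- s) F i) <= \sum_(i <- s) P (F i))%E.
Proof.
move=> mF; elim: s => [|i s IH]; first by rewrite !big_nil measure0.
rewrite !big_cons; apply: le_trans (measureU2 _ _ _) _ => //.
  exact: bigsetU_measurable.
exact: leeD2l.
Qed.

Lemma miss_probability_le m (X : 'I_m -> {RV P >-> T}) (B : set T) (t : R) :
  measurable B -> t <= 1 ->
  (forall A : 'I_m -> set T, (forall k, measurable (A k)) ->
    (P (\bigcap_k (X k @^-1` A k)) = \prod_(k < m) P (X k @^-1` A k))%E) ->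
  (forall k, (t%:E <= P (X k @^-1` B))%E) ->
  (P (\bigcap_k (X k @^-1` (~` B))) <= ((1 - t) ^+ m)%:E)%E.
Proof.
move=> mB t1 Xind XB; rewrite (Xind (fun=> ~` B)); last by move=> _; exact: measurableC.
have mX k : measurable (X k @^-1` B) by exact: measurable_preimage_RV.
have le k : (0 <= P (X k @^-1` (~` B)) <= (1 - t)%:E)%E.
  rewrite measure_ge0 andTb preimage_setC probability_setC; last exact: mX.
  by rewrite EFinB; apply: leeB => //; exact: XB.
rewrite (_ : ((1 - t) ^+ m)%:E = \prod_(k < m) (1 - t)%:E)%E; last first.
  by rewrite prodEFin prodr_const card_ord.
apply: (@proj2 (0 <= \prod_(k < m) P (X k @^-1` (~` B)))%E).
elim/big_ind2: _ => [|a b c e [a0 ab] [c0 ce]|k _]; first by split.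
  by split; [exact: mule_ge0|exact: lee_pmul].
by apply/andP.
Qed.

End covering_events.

Section admissible_mesh.
Context {R : realType} {d : nat}.
Variables (mu : probability (borel_rV R d) R) (D : set 'rV[R]_d).
Context {V : set ('rV[R]_d -> R[i])} {N : nat}.
Variable v : 'I_N -> 'rV[R]_d -> R[i].
Hypothesis v_basis : orthonormal_basis mu D V v.
Hypothesis K_fin : (kernel_sup D v < +oo)%E.
Hypothesis cD : convex_set (D : set (convex_lmodType 'rV[R]_d)).
Hypothesis kD : compact D.
Hypothesis V_C2 : forall f, V f -> complex_C2_on D f.
Hypothesis g_gt0 : forall x, D x -> 0 < grad_norm D v x.

Local Notation f := (fun x => (grad_norm D v x)^-1).
Local Notation eps := ((3 * grad_norm_max D v)^-1).
Local Notation rad := (cover_radius D f eps).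

Lemma basis_C1 i :
  C1_on D (fun x => complex.Re (v i x)) /\ C1_on D (fun x => complex.Im (v i x)).
Proof.
have vi : V (v i).
  rewrite (_ : v i = lincomb v (basis_vec i)); first exact: (lincomb_mem v_basis).
  apply/funext => x; rewrite /lincomb (bigD1 i)//= /basis_vec eqxx mul1r big1 ?addr0//.
  by move=> j ij; rewrite (negbTE ij) mul0r.
by have [[? _] [? _]] := V_C2 vi.
Qed.

Lemma sqnorm_le_sup c S : 0 <= S ->
  (forall x, D x -> Normc.normc (lincomb v c x) <= S) -> sqnorm c <= S ^+ 2.
Proof.
move=> S0 cS; rewrite -lee_fin -(integral_lincomb v_basis K_fin).
apply: (@le_trans _ _ (\int[mu]_x (S ^+ 2)%:E)%E); last first.
  by rewrite integral_cst// [X in (_ * X)%E](@probability_setT _ _ _ mu) mule1.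
apply: ge0_le_integral => //.
- by move=> x _; rewrite lee_fin sqr_ge0.
- by apply/measurable_EFinP; exact: (measurable_sqr_normc_lincomb v_basis).
move=> x _; rewrite lee_fin; apply: lerXn2r; rewrite ?nnegrE ?normc_ge0//.
have [Dx|nDx] := pselect (D x); first exact: cS.
rewrite /lincomb big1 ?Normc.normc0// => i _.
by rewrite (basis_outside v_basis i nDx) mulr0.
Qed.

(** A point and a sample in the same ball are compared through its centre; each comparison costs a
    third of the supremum. *)
Lemma mesh_of_hitting (A : {fset 'rV[R]_d}) m (X : 'I_m -> 'rV[R]_d) h :
  D !=set0 -> weighted_covering D f eps A ->
  (forall y, y \in A -> exists k, (eball y (rad y) `&` D) (X k)) -> V h ->
  (ereal_sup [set (Normc.normc (h x))%:E | x in D] <=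
   (3 * \big[Num.max/0]_(k < m) Normc.normc (h (X k)))%:E)%E.
Proof.
move=> [x0 Dx0] [AD [r [rP cov]]] hit Vh.
have [c ->] := basis_lincomb v_basis Vh; set F := lincomb v c.
have cg := continuous_grad_norm basis_C1.
set Mx := \big[_/_]_(k < m) _.
pose Sset := [set Normc.normc (F x) | x in D].
(* The supremum must be finite to be absorbed on the left; bounding by [1 + |F|^2] avoids a square
   root. *)
have Sub : has_ubound Sset.
  exists (1 + fine (kernel_sup D v) * sqnorm c) => _ [x Dx <-].
  have := normc_lincomb_le v_basis K_fin c x; rewrite -/F => le.
  apply: le_trans (_ : 1 + Normc.normc (F x) ^+ 2 <= _); last by rewrite lerD2l.
  by have := sqr_ge0 (Normc.normc (F x) - 1); have := normc_ge0 (F x); nra.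
set S := sup Sset.
have leS x : D x -> Normc.normc (F x) <= S by move=> Dx; apply: ub_le_sup => //; exists x.
have S0 : 0 <= S by apply: le_trans (leS _ Dx0); exact: normc_ge0.
have cS : Num.sqrt (sqnorm c) <= S.
  by rewrite -(ger0_norm S0) -sqrtr_sqr ler_wsqrtr//; exact: sqnorm_le_sup.
have close y x : D y -> D x -> enorm (x - y) <= rad y -> Normc.normc (F x - F y) <= S / 3.
  move=> Dy Dx xy; have r0 := cover_radius_gt0 kD g_gt0 cg Dy.
  have r3 : 0 < 3 * rad y by rewrite mulr_gt0.
  have Dseg s : 0 <= s <= 1 -> D (y + s *: (x - y)) by exact: convex_segment.
  have gM s : 0 < s < 1 -> grad_norm D v (y + s *: (x - y)) <= (3 * rad y)^-1.
    move=> /andP[s0 s1]; have s01 : 0 <= s <= 1 by rewrite !ltW.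
    have : 3 * rad y <= f (y + s *: (x - y)).
      apply: (cover_ball_le cD kD g_gt0 cg Dy (Dseg _ s01)).
      rewrite addrAC subrr add0r enormZ gtr0_norm//; apply: le_trans xy.
      by rewrite ler_piMl ?enorm_ge0// ltW.
    by move=> le; rewrite -[leLHS]invrK lef_pV2 ?posrE ?invr_gt0 ?g_gt0//; exact: Dseg.
  have i0 : 0 <= (3 * rad y)^-1 by rewrite invr_ge0 ltW.
  have := lincomb_mean_value basis_C1 c i0 Dseg gM; rewrite [y + _]addrC subrK => le.
  apply: le_trans le _.
  apply: ler_pM; [exact: sqrtr_ge0|by rewrite mulr_ge0// enorm_ge0|exact: cS|].
  by rewrite ler_pdivrMl// mulrAC mulfV// mul1r.
have main x : D x -> Normc.normc (F x) <= Mx + S / 3 + S / 3.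
  move=> Dx; have [y yA xy] := cov _ Dx.
  have [k [ky Dk]] := hit y yA.
  have Dy : D y by exact: AD.
  have h1 : Normc.normc (F x - F y) <= S / 3.
    by apply: close => //; apply: le_trans xy _; case/andP: (rP _ yA).
  have h2 := close _ _ Dy Dk ky.
  have h3 : Normc.normc (F (X k)) <= Mx.
    exact: (@le_bigmax _ _ _ _ (fun k => Normc.normc (F (X k)))).
  rewrite (_ : F x = F (X k) + (- (F (X k) - F y)) + (F x - F y)); last by ring.
  apply: le_trans (le_normcD _ _) _; apply: lerD => //.
  apply: le_trans (le_normcD _ _) _; apply: lerD => //.
  by rewrite normcN.
have SM : S <= Mx + S / 3 + S / 3.
  by apply: ge_sup; [exists (Normc.normc (F x0)), x0|move=> _ [x Dx <-]; exact: main].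
apply: ge_ereal_sup => _ [x Dx <-]; rewrite lee_fin.
by apply: le_trans (leS _ Dx) _; lra.
Qed.

End admissible_mesh.

Section am.
Context {R : realType} {d : nat}.
Variables (mu : probability (borel_rV R d) R) (D : set 'rV[R]_d).
Variables (V : nat -> set ('rV[R]_d -> R[i])) (N : nat -> nat).
Unset Implicit Arguments.
Variable v : forall n, 'I_(N n) -> 'rV[R]_d -> R[i].
Set Implicit Arguments.
Hypothesis v_basis : forall n, orthonormal_basis mu D (V n) (v n).
Hypothesis N_gt0 : forall n, (0 < N n)%N.
Hypothesis N_lt : forall n, (N n < N n.+1)%N.
Hypothesis K_fin : forall n, (kernel_sup D (v n) < +oo)%E.
Hypothesis cD : convex_set (D : set (convex_lmodType 'rV[R]_d)).
Hypothesis kD : compact D.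
Hypothesis iD : interior D !=set0.
Hypothesis V_C2 : forall n f, V n f -> complex_C2_on D f.
Hypothesis g_gt0 : forall n x, D x -> 0 < grad_norm D (v n) x.
Hypothesis p_fin : (p_star D v < +oo)%E.
Variable eps : R.
Hypothesis eps_gt0 : 0 < eps.

Local Notation p := (fine (p_star D v)).

Lemma covering_eventually (e : R) : 0 < e -> exists n0, forall n, (n0 <= n)%N ->
  exists2 A : {fset 'rV[R]_d},
    weighted_covering D (fun x => (grad_norm D (v n) x)^-1)
      ((3 * grad_norm_max D (v n))^-1) A &
    #|` A|%:R * distortion D (fun x => (grad_norm D (v n) x)^-1)
      ((3 * grad_norm_max D (v n))^-1) A < (N n)%:R `^ (p + e).
Proof.
move=> e0; have [n0 n0P] := limn_esup_fine_lt p_fin e0.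
exists (maxn n0 1) => n; rewrite geq_max => /andP[h0 h1].
have : (covering_cost D (fun x => (grad_norm D (v n) x)^-1)%R
    ((3 * grad_norm_max D (v n))^-1)%R < ((N n)%:R `^ (p + e))%R%:E)%E.
  apply: lt_powR_of_lne; last exact: n0P.
  - apply: le_ereal_inf_tmp => _ [A _ <-]; rewrite lee_fin mulr_ge0//.
    exact: bigmax_ge_id.
  - by rewrite ltr1n; apply: leq_ltn_trans h1 (dim_ge N_gt0 N_lt n).
by move=> /ereal_inf_lt[_ [A covA <-]]; rewrite lte_fin; exists A.
Qed.

Lemma am_grad_measure :
  random_admissible_mesh D V N (fun n => grad_measure D (v n)) (p + eps) 0.
Proof.
have e2 : 0 < eps / 2 by rewrite divr_gt0.
have -> : p + eps = p + eps / 2 + eps / 2 by rewrite -addrA -splitr.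
have [n0 n0P] := covering_eventually e2.
have [rho [M [rho0 M0 DM cubeD]]] := convex_ball_volume cD kD iD.
pose c0 : R := Num.min 1 ((2 * rho / (3 * M)) ^+ d).
have c00 : 0 < c0 by rewrite lt_min ltr01/= exprn_gt0// divr_gt0// mulr_gt0.
have [x0 Dx0] : D !=set0 by have [x /interior_subset Dx] := iD; exists x.
have [C C0 CP] := pow_truncn_decay (p + eps / 2) e2 c00.
pose m n := Num.truncn ((N n)%:R `^ (p + eps / 2 + eps / 2) : R).
apply: (@random_admissible_meshI _ _ _ _ _ _ _ _ m 1 3 (2 * C) n0).
  by move=> n _; rewrite mul1r truncn_le powR_ge0.
move=> n h disp Om P X [Xrho Xind].
have [A covA costA] := n0P n h.
set r := cover_radius D (fun x => (grad_norm D (v n) x)^-1) ((3 * grad_norm_max D (v n))^-1).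
have C1 := basis_C1 (v_basis n) (@V_C2 n).
have cg := continuous_grad_norm C1.
(* Since [D] is nonempty, so is the covering; this yields |A| G >= 1, hence [B >= 1] whatever the
   sign of its exponent. *)
have [y0 y0A _] : exists2 y, y \in A & True.
  by have [_ [rr [_ /(_ _ Dx0)[y yA _]]]] := covA; exists y.
have G1 := distortion_ge1 kD (@g_gt0 n) cg covA y0A.
set G := distortion _ _ _ _ in G1 costA.
have A1 : 1 <= #|` A|%:R :> R.
  by rewrite ler1n cardfs_gt0; apply/fset0Pn; exists y0.
set B := (N n)%:R `^ (p + eps / 2) in costA.
have AG1 : 1 <= #|` A|%:R * G by rewrite -[leLHS]mul1r; apply: ler_pM.
have B1 : 1 <= B by apply: le_trans AG1 (ltW costA).
have B0 : 0 < B := lt_le_trans ltr01 B1.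
pose t := c0 / B.
have t01 : 0 <= t <= 1.
  apply/andP; split; first by apply: divr_ge0; exact: ltW.
  rewrite ler_pdivrMr// mul1r; apply: le_trans B1.
  by rewrite ge_min lexx.
have mB y : measurable (eball y (r y) `&` D : set (borel_rV R d)).
  exact: measurable_ball_inter.
pose F y : set Om := \bigcap_k (X k @^-1` (~` (eball y (r y) `&` D))).
have mF y : measurable (F y).
  apply: fin_bigcap_measurable; first exact: (@finite_finset 'I_(m n)).
  by move=> k _; apply: measurable_preimage_RV; exact: measurableC.
have PF y : y \in A -> (P (F y) <= ((1 - t) ^+ m n)%:E)%E.
  move=> yA; apply: (miss_probability_le (mB y)) => //; first by case/andP: t01.
  move=> k; have -> : P (X k @^-1` (eball y (r y) `&` D)) =
      grad_measure D (v n) (eball y (r y) `&` D) by rewrite -(Xrho k)//; exact: mB.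
  rewrite /grad_measure -setIA setIid.
  apply: le_trans (ball_ratio_ge cD kD (@g_gt0 n) cg covA rho0 M0 DM cubeD yA).
  rewrite lee_fin; apply: ler_wpM2l; first exact: ltW.
  by rewrite lef_pV2 ?posrE ?ltW// (lt_le_trans ltr01).
exists (\big[setU/set0]_(y <- A) F y); split.
- by apply: bigsetU_measurable => y _; exact: mF.
- apply: le_trans (probability_bigsetU_le _ _ mF) _.
  apply: (@le_trans _ _ (\sum_(y <- A) ((1 - t) ^+ m n)%:E)%E).
    by rewrite big_seq [leRHS]big_seq; apply: lee_sum => y yA; exact: PF.
  rewrite sumEFin lee_fin.
  apply: le_trans (inv_sqr_le_telescope (x := (N n)%:R) C0 _); last first.
    by rewrite ler_nat; exact: (dim_ge N_gt0 N_lt).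
  rewrite (_ : \sum_(y <- A) (1 - t) ^+ m n = #|` A|%:R * (1 - t) ^+ m n); last first.
    rewrite card_fset_sum1 natr_sum mulr_suml; apply: eq_bigr => y _.
    by rewrite mul1r.
  (* The union bound has |A| terms, and |A| <= |A| G < B because G >= 1; this is the power of N that
     the decay estimate has to beat. *)
  apply: (@le_trans _ _ (B * (1 - t) ^+ m n)).
    apply: ler_wpM2r; first by rewrite exprn_ge0// subr_ge0; case/andP: t01.
    apply: le_trans (ltW costA); rewrite -[leLHS]mulr1; apply: ler_wpM2l => //.
  by apply: CP => //; exact: dim_ge1.
move=> w wE f Vf; rewrite powRr0 mulr1.
apply: (mesh_of_hitting (v_basis n) (K_fin n) cD kD (@V_C2 n) (@g_gt0 n) _ covA) => //.
  by exists x0.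
move=> y yA; apply: contrapT => nhit; apply: wE.
rewrite -bigcup_seq; exists y => // k _ /= Xk; apply: nhit; exists k.
exact: Xk.
Qed.

End am.

Theorem theorem1p1 (R : realType) (d : nat)
    (mu : probability (borel_rV R d) R)
    (D : set 'rV[R]_d) (D_supp : D = msupport mu)
    (V : nat -> set ('rV[R]_d -> R[i])) (N : nat -> nat)
    (v : forall n, 'I_(N n) -> 'rV[R]_d -> R[i])
    (v_basis : forall n, orthonormal_basis mu D (V n) (v n))
    (N_gt0 : forall n, (0 < N n)%N)
    (V_sub : forall n, V n `<=` V n.+1)
    (N_lt : forall n, (N n < N n.+1)%N)
    (K_fin : forall n, (kernel_sup D (v n) < +oo)%E)
    (q_fin : (q_star D v < +oo)%E)
    (eps : R) (eps_gt0 : 0 < eps) :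
  [/\ random_admissible_mesh D V N (fun=> mu)
        (fine (q_star D v) + eps) (fine (q_star D v) / 2 + eps),
      (V 0%N (\1_D) ->
       random_admissible_mesh D V N (fun n => induced_measure mu (v n))
         (1 + eps) ((fine (q_star D v) + 1) / 2 + eps)) &
      (convex_set (D : set (convex_lmodType 'rV[R]_d)) -> compact D ->
       interior D !=set0 ->
       (forall n f, V n f -> complex_C2_on D f) ->
       (forall n x, D x -> 0 < grad_norm D (v n) x) ->
       (p_star D v < +oo)%E ->
       random_admissible_mesh D V N (fun n => grad_measure D (v n))
         (fine (p_star D v) + eps) 0)].
Proof.
split.
- exact: wam_measure.
- exact: wam_induced_measure.
- by move=> cD kD iD V_C2 g_gt0 p_fin; exact: (@am_grad_measure _ _ mu).
Qed.
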